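(* Let $\mu$ be the standard Gaussian measure on $\mathbb{R}$, i.e. $\mu(dx) = (2\pi)^{-1/2}e^{-x^2/2}\,dx$, let $b>0$, and let $\sigma$ be the positive function given by $\sigma^2(x) = \frac{1}{1+bx^2}$, $x \in \mathbb{R}$. Let $$\mathcal{L}_\mu^\sigma f(x) = \sigma^2(x) f''(x) + \left((\sigma^2)'(x) - x\,\sigma^2(x)\right) f'(x).$$ Then the spectral gap of the operator $-\mathcal{L}_\mu^\sigma$ in $L^2(\mu)$ is given by $$\lambda_1(-\mathcal{L}_\mu^\sigma) = \begin{cases} 1-b & \text{if } 0<b<1/2,\\[2pt] \dfrac{1}{4b} & \text{if } b \ge 1/2.\end{cases}$$ In other words, the value above is the best (largest) constant $\lambda>0$ such that the following weighted Poincaré inequality holds: for every $f \in \mathcal{C}_0^\infty(\mathbb{R})$, $$\lambda\, \mathrm{Var}_\mu(f) \le \int_{\mathbb{R}} \frac{f'(x)^2}{1+bx^2}\,\mu(dx).$$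
   Context: $\mathcal{C}_0^\infty(\mathbb{R})$ denotes the smooth compactly supported real-valued functions on $\mathbb{R}$, and $\mathrm{Var}_\mu(f) = \int_{\mathbb{R}} f^2\,d\mu - \left(\int_{\mathbb{R}} f\,d\mu\right)^2$. The operator $\mathcal{L}_\mu^\sigma$ is defined on $\mathcal{C}_0^\infty(\mathbb{R})$, is essentially self-adjoint, and the same notation is used for its self-adjoint extension in $L^2(\mu)$, whose Dirichlet form is $-\int_{\mathbb{R}} f\mathcal{L}_\mu^\sigma f\,d\mu = \int_{\mathbb{R}} \sigma^2 (f')^2\,d\mu$ with domain $H^1_\sigma(\mathbb{R},\mu) = \{ f\in L^2(\mu) : \int_{\mathbb{R}} \sigma^2 (f')^2\,d\mu<\infty\}$ ($f'$ being the weak derivative). The spectral gap $\lambda_1(-\mathcal{L}_\mu^\sigma)$ is the largest real $\lambda$ such that the spectrum of $-\mathcal{L}_\mu^\sigma$ lies in $\{0\}\cup[\lambda,+\infty)$; it is characterized by $$\lambda_1(-\mathcal{L}_\mu^\sigma) = \inf\left\{ \frac{\int_{\mathbb{R}} \sigma^2 (f')^2\,d\mu}{\mathrm{Var}_\mu(f)} : f \in H^1_\sigma(\mathbb{R},\mu),\ f\ne\text{const}\right\}.$$ *)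

(* Defs.v *)
From mathcomp Require Import all_boot all_order all_algebra.
From mathcomp Require Import all_classical all_reals all_analysis.
Set Implicit Arguments.
Unset Strict Implicit.
Unset Printing Implicit Defensive.
Import Order.TTheory GRing.Theory Num.Theory.
Import numFieldNormedType.Exports.
Local Open Scope classical_set_scope.
Local Open Scope ring_scope.

Definition is_largest (R : realType) (E : set R) (m : R) : Prop :=
  E m /\ ubound E m.

(* Unbounded operators in the real Hilbert space L^2(mu), given by their graphs:
   sets of pairs (f, A f) of square-integrable functions. Elements of L^2(mu)
   are represented by functions, equality in L^2(mu) being a.e. equality. *)
Section L2_operators.
Context d (T : measurableType d) (R : realType).
Variable mu : {measure set T -> \bar R}.
Implicit Types A G : set ((T -> R) * (T -> R)).

Definition L2norm (f : T -> R) : \bar R := 'N[mu]_2%:E[EFin \o f].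

(* The graph of the closure of an operator with graph G. For an essentially
   self-adjoint operator this is its unique self-adjoint extension. *)
Definition L2closure G : set ((T -> R) * (T -> R)) :=
  [set p | [/\ p.1 \in Lfun mu 2%:E, p.2 \in Lfun mu 2%:E &
    exists q : nat -> (T -> R) * (T -> R),
      [/\ forall n, G (q n),
          (fun n => L2norm (p.1 \- (q n).1)) @ \oo --> 0%E &
          (fun n => L2norm (p.2 \- (q n).2)) @ \oo --> 0%E]]].

(* A - z maps the domain of A bijectively onto L^2(mu), with bounded inverse;
   injectivity is contained in the norm bound. *)
Definition resolvent_set A : set R :=
  [set z | (exists C : R, forall f g, A (f, g) ->
              (L2norm f <= C%:E * L2norm (fun x => g x - z * f x)%R)%E) /\
           (forall h, h \in Lfun mu 2%:E ->
              exists f g, A (f, g) /\ (fun x => g x - z * f x) = h %[ae mu])].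

(* Only real z are considered: a self-adjoint operator has real spectrum. *)
Definition spectrum A : set R := ~` resolvent_set A.

Definition is_spectral_gap A (l : R) : Prop :=
  is_largest [set l' | spectrum A `<=` [set 0] `|` [set` `[l', +oo[]] l.

End L2_operators.

Definition gaussian (R : realType) : probability (measurableTypeR R) R :=
  normal_prob 0 1.

Definition C0infty (R : realType) : set (R -> R) :=
  [set f | (forall n x, derivable (derive1n n f) x 1) /\
           compact (closure [set x | f x != 0])].

Definition Var (R : realType) (mu : {measure set (measurableTypeR R) -> \bar R})
    (f : R -> R) : R :=
  (\int[mu]_x (f x ^+ 2)) - (\int[mu]_x f x) ^+ 2.

Definition Lop (R : realType) (sigma f : R -> R) (x : R) : R :=
  sigma x ^+ 2 * derive1n 2 f x
  + (derive1 (fun y => sigma y ^+ 2) x - x * sigma x ^+ 2) * derive1 f x.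

(* Lop is essentially self-adjoint on C0infty, so the closure is self-adjoint. *)
Definition minusL (R : realType) (sigma : R -> R) : set ((R -> R) * (R -> R)) :=
  L2closure (gaussian R)
    [set p | C0infty p.1 /\ p.2 = (fun x => - Lop sigma p.1 x)].

(* Main.v *)
Require Import Defs.
From mathcomp Require Import all_boot all_order all_algebra finmap.
From mathcomp Require Import all_classical all_reals all_analysis.
From mathcomp Require Import measurable_realfun ring lra.
Set Implicit Arguments.
Unset Strict Implicit.
Unset Printing Implicit Defensive.
Import Order.TTheory GRing.Theory Num.Theory.
Import numFieldNormedType.Exports.
Local Open Scope classical_set_scope.
Local Open Scope ring_scope.

(* Put a = min(b, 1/2), so that the claimed gap l satisfies a (1 - a) = l b and
   l <= 1 - a. Comparing f - f(0) with the ground state x e^(a x^2 / 2) of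
   A = - L on each half-line gives a pointwise inequality, exact up to a
   derivative, which integrates to l Var(f) <= int f A f.
   For the spectrum below l, the equation A f = h with h of mean zero is solved
   explicitly by integrating twice, and the coercivity of A - z on mean-zero
   functions makes the residual iteration converge, so that A - z has dense
   range on test functions for every nonzero z < l; with completeness of L^2 the
   closure of A then has a bounded resolvent at z.
   At l itself, smooth truncations of the ground state are almost eigenvectors
   of A, which puts l in the spectrum and shows that no larger constant is
   possible in the Poincare inequality. *)

(** The relation [a (1 - a) = l b] is what cancels the leading term at infinity of [A g - l g] for
    [g = x e^(a x^2 / 2)], and [min(b, 1/2)] maximizes [a (1 - a) / b] over [0 < a <= b]. Against
    the Gaussian density, [g^2] behaves like [x^2 e^(- (1/2 - a) x^2)]: for [b < 1/2] the choice
    [a = b] gives a true eigenfunction, and at [a = 1/2] square integrability is lost, whence the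
    threshold. The centre is [f 0] and not the mean because [g] vanishes only at 0: [f - f 0]
    absorbs the pole of [g' / g] there, and the variance is at most the second moment about any
    point. The obstacle is compact support. Constants span the kernel of [A], and the explicit
    solutions of [A f = h] are constant near each end, possibly with two different values; neither
    are test functions. Cutoffs repair this because the weight decays like [x^-2], so the drift of
    [A] is bounded and [A] sends a cutoff of width [n] to a function of size [O(1/n)], uniformly.
    Hence the dense range, from which the resolvent of the closure is built by hand. *)

Section derivation_rules.
Variable R : realType.
Implicit Types f g : R -> R.

Lemma drv_cst (c x : R) : is_derive x (1 : R) (fun _ : R => c) 0.
Proof. exact: is_derive_cst. Qed.

Lemma drv_id (x : R) : is_derive x (1 : R) (fun y : R => y) 1.
Proof. exact: is_derive_id. Qed.

Lemma drvD f g (x a c : R) : is_derive x 1 f a -> is_derive x 1 g c ->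
  is_derive x 1 (fun y => f y + g y) (a + c).
Proof. by move=> fa gc; exact: is_deriveD. Qed.

Lemma drvN f (x a : R) : is_derive x 1 f a ->
  is_derive x 1 (fun y => - f y) (- a).
Proof. by move=> fa; exact: is_deriveN. Qed.

Lemma drvB f g (x a c : R) : is_derive x 1 f a -> is_derive x 1 g c ->
  is_derive x 1 (fun y => f y - g y) (a - c).
Proof. by move=> fa gc; exact: is_deriveB. Qed.

Lemma drvM f g (x a c : R) : is_derive x 1 f a -> is_derive x 1 g c ->
  is_derive x 1 (fun y => f y * g y) (a * g x + f x * c).
Proof.
move=> fa gc; apply: is_derive_eq (is_deriveM fa gc) _.
by rewrite /GRing.scale/= addrC mulrC.
Qed.

Lemma drvX f n (x a : R) : is_derive x 1 f a ->
  is_derive x 1 (fun y => f y ^+ n) (n%:R * f x ^+ n.-1 * a).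
Proof.
move=> fa; rewrite (_ : (fun y => _) = f ^+ n); first exact: is_deriveX.
by apply/funext => y; rewrite exprfctE.
Qed.

Lemma drv_comp f g (x a c : R) : is_derive (g x) 1 f a -> is_derive x 1 g c ->
  is_derive x 1 (fun y => f (g y)) (a * c).
Proof. by move=> fa gc; exact: is_derive1_comp. Qed.

Lemma drvV f (x a : R) : f x != 0 -> is_derive x 1 f a ->
  is_derive x 1 (fun y => (f y)^-1) (- a / f x ^+ 2).
Proof.
move=> f0 fa; apply: is_derive_eq (is_deriveV f0 fa) _.
by rewrite /GRing.scale/= mulNr mulrC mulNr.
Qed.

Lemma drv_expR f (x a : R) : is_derive x 1 f a ->
  is_derive x 1 (fun y => expR (f y)) (expR (f x) * a).
Proof. by move=> fa; apply: drv_comp. Qed.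

Lemma drv_derive1 f (x a : R) : is_derive x 1 f a -> derive1 f x = a.
Proof. by move=> fa; rewrite derive1E derive_val. Qed.

Lemma derive1_drv f (x : R) : derivable f x 1 -> is_derive x 1 f (derive1 f x).
Proof. by move=> df; rewrite derive1E; exact: derivableP. Qed.

Lemma drv_derivable f (x a : R) : is_derive x 1 f a -> derivable f x 1.
Proof. by case. Qed.

Lemma drv_continuous f (x a : R) : is_derive x 1 f a -> {for x, continuous f}.
Proof.
by move=> fa; apply/differentiable_continuous/derivable1_diffP; case: fa.
Qed.

Lemma drv_local f g (x a : R) : (\near x, f x = g x) -> is_derive x 1 f a ->
  is_derive x 1 g a.
Proof. exact: near_eq_is_derive. Qed.

(** The difference quotient at [x] is at most [C * |y - x|]. This serves where two pieces of a
    piecewise definition are glued. *)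
Lemma drv0_sqr_bound f (x C : R) :
  (forall y, `|f y - f x| <= C * (y - x) ^+ 2) -> is_derive x 1 f 0.
Proof.
move=> fC; apply/is_derive1_caratheodory.
exists (fun y => if y == x then 0 else (f y - f x) / (y - x)); split.
- move=> z; case: eqP => [->|/eqP]; first by rewrite !subrr mulr0.
  by rewrite -subr_eq0 => /divfK->.
- rewrite /prop_for /continuous_at eqxx.
  have C0 : 0 <= C.
    have := fC (x + 1); rewrite addrAC subrr add0r expr1n mulr1.
    exact: le_trans.
  apply/cvgrPdist_le => e e0.
  have eC0 : 0 < e / (C + 1) by rewrite divr_gt0// ltr_wpDl.
  near=> y.
  rewrite sub0r normrN; case: ifPn => [_|yx]; first by rewrite normr0 ltW.
  have yx0 : 0 < `|y - x| by rewrite normr_gt0 subr_eq0.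
  rewrite normrM normfV ler_pdivrMr//.
  apply: le_trans (fC y) _.
  rewrite -(real_normK (num_real (y - x))) expr2 mulrA ler_pM2r//.
  have : `|y - x| < e / (C + 1).
    by rewrite distrC; near: y; apply/nbhs_ballP; exists (e / (C + 1)).
  rewrite ltr_pdivlMr ?ltr_wpDl// => h.
  apply: le_trans (ltW h); rewrite mulrDr mulr1 mulrC lerDl.
  exact: ltW.
- by rewrite eqxx.
Unshelve. all: by end_near. Qed.

End derivation_rules.

(** The derivative is synthesized from the shape of the function, hypotheses about its parts being
    tried first. A nonvanishing denominator is left as a goal, and [derive_as] also leaves the
    equation between the synthesized value and the announced one. *)
Ltac drv := repeat match goal with
  | H : is_derive _ _ ?f _ |- is_derive _ _ ?f _ => exact H
  | H : forall _, is_derive _ _ ?f _ |- is_derive _ _ ?f _ => exact (H _)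
  | |- is_derive _ _ (fun y => y) _ => exact (drv_id _)
  | |- is_derive _ _ (fun _ => ?c) _ => exact (drv_cst _ _)
  | |- is_derive _ _ (fun y => - (@?f y)) _ =>
      notypeclasses refine (@drvN _ f _ _ _)
  | |- is_derive _ _ (fun y => @?f y - @?g y) _ =>
      notypeclasses refine (@drvB _ f g _ _ _ _ _)
  | |- is_derive _ _ (fun y => @?f y + @?g y) _ =>
      notypeclasses refine (@drvD _ f g _ _ _ _ _)
  | |- is_derive _ _ (fun y => @?f y * @?g y) _ =>
      notypeclasses refine (@drvM _ f g _ _ _ _ _)
  | |- is_derive _ _ (fun y => (@?f y) ^+ ?n) _ =>
      notypeclasses refine (@drvX _ f n _ _ _)
  | |- is_derive _ _ (fun y => (@?f y)^-1) _ =>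
      notypeclasses refine (@drvV _ f _ _ _ _)
  | |- is_derive _ _ (fun y => expR (@?f y)) _ =>
      notypeclasses refine (@drv_expR _ f _ _ _)
  end.

Ltac derive_as := notypeclasses refine (is_derive_eq _ _); [drv|].

(** * Smooth functions and their closure properties *)

Section smooth_functions.
Variable R : realType.
Implicit Types f g : R -> R.

(* Off by one: [Ck n f] says that [f] is [n.+1] times differentiable. *)
Fixpoint Ck n f : Prop :=
  (forall x, derivable f x 1) /\ (if n is m.+1 then Ck m (derive1 f) else True).

Definition smooth f := forall n, Ck n f.

(** [derive1n] iterates from outside whereas [Ck] recurses on [derive1 f]; the second form is the
    one in which the product and chain rules go through by induction. *)
Lemma smoothE f : smooth f <-> forall n x, derivable (derive1n n f) x 1.
Proof.
split=> [sf n|].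
  suff : forall n f, Ck n f -> forall x, derivable (derive1n n f) x 1 by apply.
  elim=> [|m ih] h [dh h'm]; first exact: dh.
  by rewrite derive1Sn; exact: ih.
move=> sf n; elim: n f sf => [|n ih] f sf; first by split=> // x; exact: (sf 0).
split; first by move=> x; exact: (sf 0).
by apply: ih => m; rewrite -derive1Sn.
Qed.

Lemma smooth_drv f (x : R) : smooth f -> is_derive x 1 f (derive1 f x).
Proof. by move=> /(_ 0)[+ _] => df; exact: derive1_drv. Qed.

Lemma smooth_derive1 f : smooth f -> smooth (derive1 f).
Proof. by move=> sf n; have [_] := sf n.+1. Qed.

Lemma smooth_cont f : smooth f -> continuous f.
Proof. by move=> sf x; exact: drv_continuous (smooth_drv x sf). Qed.

Lemma CkS_drv n f f' : (forall x : R, is_derive x 1 f (f' x)) -> Ck n f' -> Ck n.+1 f.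
Proof.
move=> ff' f'n; split; first by move=> x; exact: drv_derivable (ff' x).
by rewrite (_ : derive1 f = f')//; apply/funext => x; exact: drv_derive1.
Qed.

Lemma Ck_pred n f : Ck n.+1 f -> Ck n f.
Proof. by elim: n f => [|n ih] f [df]; [case | move=> /ih]. Qed.

Lemma Ck0 f f' : (forall x : R, is_derive x 1 f (f' x)) -> Ck 0 f.
Proof. by move=> ff'; split=> // x; exact: drv_derivable (ff' x). Qed.

Lemma CkP n f : Ck n f -> forall x : R, is_derive x 1 f (derive1 f x).
Proof. by case: n => [|n] [df _] x; exact: derive1_drv. Qed.

Lemma smooth_primitive f f' : (forall x : R, is_derive x 1 f (f' x)) ->
  smooth f' -> smooth f.
Proof.
by move=> ff' sf' [|n]; [exact: Ck0 ff'|exact: CkS_drv ff' (sf' n)].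
Qed.

Lemma Ck_cst n c : Ck n (fun=> c).
Proof.
elim: n c => [|n ih] c; first by apply: Ck0 => x; exact: drv_cst.
exact: CkS_drv (fun x => drv_cst c x) (ih 0).
Qed.

Lemma smooth_cst c : smooth (fun=> c).
Proof. by move=> n; exact: Ck_cst. Qed.

Lemma smooth_id : smooth (fun x => x).
Proof. exact: smooth_primitive (@drv_id R) (smooth_cst 1). Qed.

Lemma CkD n f g : Ck n f -> Ck n g -> Ck n (fun x => f x + g x).
Proof.
elim: n f g => [|n ih] f g fn gn.
  by apply: Ck0 => x; apply: drvD; [exact: (CkP fn)|exact: (CkP gn)].
apply: CkS_drv (ih _ _ (proj2 fn) (proj2 gn)) => x.
by apply: drvD; [exact: (CkP fn)|exact: (CkP gn)].
Qed.

Lemma smoothD f g : smooth f -> smooth g -> smooth (fun x => f x + g x).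
Proof. by move=> sf sg n; exact: CkD. Qed.

Lemma CkM n f g : Ck n f -> Ck n g -> Ck n (fun x => f x * g x).
Proof.
elim: n f g => [|n ih] f g fn gn.
  by apply: Ck0 => x; apply: drvM; [exact: (CkP fn)|exact: (CkP gn)].
refine (@CkS_drv _ _ (fun x => derive1 f x * g x + f x * derive1 g x) _ _).
  by move=> x; apply: drvM; [exact: (CkP fn)|exact: (CkP gn)].
apply: CkD; apply: ih; try exact: Ck_pred; first exact: (proj2 fn).
exact: (proj2 gn).
Qed.

Lemma smoothM f g : smooth f -> smooth g -> smooth (fun x => f x * g x).
Proof. by move=> sf sg n; exact: CkM. Qed.

Lemma smoothN f : smooth f -> smooth (fun x => - f x).
Proof.
move=> sf; rewrite (_ : (fun _ => _) = fun x => -1 * f x).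
  by apply: smoothM => //; exact: smooth_cst.
by apply/funext => x; rewrite mulN1r.
Qed.

Lemma smoothB f g : smooth f -> smooth g -> smooth (fun x => f x - g x).
Proof. by move=> sf sg; apply: smoothD => //; exact: smoothN. Qed.

Lemma smoothX f n : smooth f -> smooth (fun x => f x ^+ n).
Proof.
move=> sf; elim: n => [|n ih].
  by under eq_fun do rewrite expr0; exact: smooth_cst.
by under eq_fun do rewrite exprS; exact: smoothM.
Qed.

Lemma Ck_comp n f g : Ck n f -> Ck n g -> Ck n (fun x => f (g x)).
Proof.
elim: n f g => [|n ih] f g fn gn.
  by apply: Ck0 => x; apply: drv_comp; [exact: (CkP fn)|exact: (CkP gn)].
refine (@CkS_drv _ _ (fun x => derive1 f (g x) * derive1 g x) _ _).
  by move=> x; apply: drv_comp; [exact: (CkP fn)|exact: (CkP gn)].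
by apply: CkM; [apply: ih; [exact: (proj2 fn)|exact: Ck_pred]|exact: (proj2 gn)].
Qed.

Lemma smooth_comp f g : smooth f -> smooth g -> smooth (fun x => f (g x)).
Proof. by move=> sf sg n; exact: Ck_comp. Qed.

(** The derivative [- f' / f^2] involves the inverse of [f] only through its square, so regularity
    of the inverse at order [n] yields order [n.+1]. *)
Lemma smoothV f : smooth f -> (forall x, f x != 0) -> smooth (fun x => (f x)^-1).
Proof.
move=> sf f0; elim=> [|n ih].
  by apply: Ck0 => x; apply: drvV => //; exact: smooth_drv.
refine (@CkS_drv _ _ (fun x => - derive1 f x / f x ^+ 2) _ _).
  by move=> x; apply: drvV => //; exact: smooth_drv.
apply: CkM; first exact: (smoothN (smooth_derive1 sf)).
under eq_fun do rewrite -exprVn expr2.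
exact: CkM.
Qed.

Lemma smooth_expR : smooth (@expR R).
Proof.
elim=> [|n ih]; first by apply: Ck0 => x; exact: is_derive_expR.
exact: CkS_drv (@is_derive_expR R) ih.
Qed.

Lemma smooth_ext f g : f =1 g -> smooth f -> smooth g.
Proof. by move=> /funext ->. Qed.

End smooth_functions.

(** * Smooth steps, cutoffs and compact support *)

Section smooth_cutoffs.
Variable R : realType.
Implicit Types f g : R -> R.

(** [y^n / n!] is a single term of the exponential series at [y]. *)
Lemma exprn_expRN_le (n : nat) (y : R) : 0 <= y -> y ^+ n * expR (- y) <= n`!%:R.
Proof.
move=> y0; rewrite expRN -ler_pdivlMr ?invr_gt0 ?expR_gt0// invrK.
case: n => [|n]; first by rewrite expr0 mul1r -expR0 ler_expR.
rewrite -ler_pdivrMl ?ltr0n ?fact_gt0// mulrC.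
by apply: le_trans (expR_ge1Dxn n y0); rewrite lerDr.
Qed.

(** The power [k] makes the family closed under differentiation, so that one induction proves all
    members smooth. *)
Definition flat (k : nat) (x : R) : R :=
  if 0 < x then x^-1 ^+ k * expR (- x^-1) else 0.

(** The factorial bound at [x^-1] with exponent [k + 2]: the two spare powers give the quadratic
    flatness that makes the derivative at 0 vanish. *)
Lemma flat_le k (x : R) : `|flat k x| <= k.+2`!%:R * x ^+ 2.
Proof.
rewrite /flat; case: ifPn => x0; last first.
  by rewrite normr0 mulr_ge0// sqr_ge0.
rewrite ger0_norm ?mulr_ge0 ?exprn_ge0 ?expR_ge0 ?invr_ge0 ?(ltW x0)//.
have xi0 : 0 <= x^-1 by rewrite invr_ge0 ltW.
rewrite -ler_pdivrMr ?exprn_gt0// -exprVn mulrAC -exprD addn2.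
exact: exprn_expRN_le.
Qed.

Lemma flat_drv k (x : R) :
  is_derive x 1 (flat k) (flat k.+2 x - k%:R * flat k.+1 x).
Proof.
case: (ltgtP x 0) => x0.
- have -> : flat k.+2 x - k%:R * flat k.+1 x = 0.
    by rewrite /flat !ltNge (ltW x0)/= mulr0 subr0.
  apply: (@drv_local _ (fun=> 0)).
  near=> y; rewrite /flat ifF//; apply/negbTE; rewrite -leNgt ltW//.
  by near: y; exact: lt_nbhsl.
- have -> : flat k.+2 x - k%:R * flat k.+1 x =
    k%:R * x^-1 ^+ k.-1 * (- 1 / x ^+ 2) * expR (- x^-1) +
    x^-1 ^+ k * (expR (- x^-1) * (- (- 1 / x ^+ 2))).
    rewrite /flat x0.
    have -> : k%:R * x^-1 ^+ k.-1 * (- 1 / x ^+ 2) = - (k%:R * x^-1 ^+ k.+1).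
      case: k => [|k]; first by rewrite !mul0r oppr0.
      by rewrite mulN1r mulrN -exprVn -mulrA -exprD addn2.
    by rewrite -exprVn !exprS; ring.
  apply: (@drv_local _ (fun y => y^-1 ^+ k * expR (- y^-1))).
    near=> y; rewrite /flat (_ : 0 < y)//.
    by near: y; exact: lt_nbhsr.
  by derive_as; rewrite ?gt_eqF.
- rewrite x0 /flat ltxx mulr0 subr0.
  apply: (@drv0_sqr_bound _ _ _ k.+2`!%:R) => y.
  by rewrite ltxx !subr0; exact: flat_le.
Unshelve. all: by end_near. Qed.

Lemma smooth_flat k : smooth (flat k).
Proof.
move=> n; elim: n k => [|n ih] k; first exact: Ck0 (flat_drv k).
refine (CkS_drv (flat_drv k) _).
apply: CkD => //.
rewrite (_ : (fun _ => _) = (fun x => - k%:R * flat k.+1 x)).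
  by apply: CkM => //; exact: Ck_cst.
by apply/funext => x; rewrite mulNr.
Qed.

(** The two summands of the denominator never vanish together, which keeps the quotient smooth while
    it climbs from 0 (for [x <= 0]) to 1 (for [x >= 1]). *)
Definition step (x : R) : R := flat 0 x / (flat 0 x + flat 0 (1 - x)).

Lemma flat0_ge0 (x : R) : 0 <= flat 0 x.
Proof. by rewrite /flat; case: ifP => // _; rewrite expr0 mul1r expR_ge0. Qed.

Lemma flat0_gt0 (x : R) : 0 < x -> 0 < flat 0 x.
Proof. by rewrite /flat => ->; rewrite expr0 mul1r expR_gt0. Qed.

Lemma step_den_gt0 (x : R) : 0 < flat 0 x + flat 0 (1 - x).
Proof.
have [x0|x0] := ltP 0 x; first by rewrite ltr_pwDl ?flat0_gt0 ?flat0_ge0.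
by rewrite ltr_wpDl ?flat0_ge0// flat0_gt0//; lra.
Qed.

Lemma smooth_step : smooth step.
Proof.
apply: smoothM; first exact: smooth_flat.
apply: smoothV => [|x]; last by rewrite gt_eqF// step_den_gt0.
apply: smoothD; first exact: smooth_flat.
apply: (@smooth_comp _ (flat 0)); first exact: smooth_flat.
by apply: smoothB; [exact: smooth_cst|exact: smooth_id].
Qed.

Lemma step_ge0 (x : R) : 0 <= step x.
Proof. by rewrite divr_ge0 ?flat0_ge0// ltW// step_den_gt0. Qed.

Lemma step_le1 (x : R) : step x <= 1.
Proof. by rewrite ler_pdivrMr ?step_den_gt0// mul1r lerDl flat0_ge0. Qed.

Lemma step0 (x : R) : x <= 0 -> step x = 0.
Proof. by move=> x0; rewrite /step /flat ltNge x0 mul0r. Qed.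

Lemma step1 (x : R) : 1 <= x -> step x = 1.
Proof.
move=> x1; rewrite /step [flat 0 (1 - x)]/flat ifF; last by apply/negbTE; lra.
by rewrite addr0 divff// gt_eqF// flat0_gt0//; lra.
Qed.

Definition cutoff (x : R) : R := step (2 - x) * step (2 + x).

Lemma smooth_cutoff : smooth cutoff.
Proof.
apply: smoothM; apply: (@smooth_comp _ step); try exact: smooth_step.
  by apply: smoothB; [exact: smooth_cst|exact: smooth_id].
by apply: smoothD; [exact: smooth_cst|exact: smooth_id].
Qed.

Lemma cutoff_ge0 (x : R) : 0 <= cutoff x.
Proof. by rewrite mulr_ge0 ?step_ge0. Qed.

Lemma cutoff_le1 (x : R) : cutoff x <= 1.
Proof. by rewrite mulr_ile1 ?step_ge0 ?step_le1. Qed.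

Lemma cutoff1 (x : R) : `|x| <= 1 -> cutoff x = 1.
Proof. by rewrite ler_norml => /andP[? ?]; rewrite /cutoff !step1 ?mulr1; lra. Qed.

Lemma cutoff0 (x : R) : 2 <= `|x| -> cutoff x = 0.
Proof.
rewrite /cutoff ler_normr => /orP[h|h].
  by rewrite (@step0 (2 - x)) ?mul0r//; lra.
by rewrite (@step0 (2 + x)) ?mulr0//; lra.
Qed.

(** A radius instead of a compact closure, so that vanishing can be used pointwise; [C0inftyE]
    connects the two. *)
Definition csupp f := exists N : R, forall x, N <= `|x| -> f x = 0.

Lemma csupp_ge f (M : R) : csupp f ->
  exists N : R, M <= N /\ forall x, N <= `|x| -> f x = 0.
Proof.
move=> [N hN]; exists (Num.max M N); split; first by rewrite le_max lexx.
by move=> x; rewrite ge_max => /andP[_ /hN].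
Qed.

Lemma csupp_derive1 f : csupp f -> csupp (derive1 f).
Proof.
move=> [N hN]; exists (N + 1) => x hx.
apply: drv_derive1; apply: (@drv_local _ (fun=> 0)).
near=> y; apply/esym/hN.
have : `|x - y| < 1 by near: y; apply/nbhs_ballP; exists 1 => /=.
move=> xy; have := ler_normD (x - y) y; rewrite subrK => h; lra.
Unshelve. all: by end_near. Qed.

Lemma csuppMl f g : csupp f -> csupp (fun x => f x * g x).
Proof. by move=> [N hN]; exists N => x /hN ->; rewrite mul0r. Qed.

Lemma csuppMr f g : csupp g -> csupp (fun x => f x * g x).
Proof. by move=> [N hN]; exists N => x /hN ->; rewrite mulr0. Qed.

Lemma csuppD f g : csupp f -> csupp g -> csupp (fun x => f x + g x).
Proof.
move=> [N hN] /(csupp_ge N)[M [NM hM]]; exists M => x Mx.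
by rewrite hM// hN ?addr0// (le_trans NM).
Qed.

Lemma csuppN f : csupp f -> csupp (fun x => - f x).
Proof. by move=> [N hN]; exists N => x /hN ->; rewrite oppr0. Qed.

Lemma csuppB f g : csupp f -> csupp g -> csupp (fun x => f x - g x).
Proof. by move=> ? ?; apply: csuppD => //; exact: csuppN. Qed.

Lemma csupp_bounded f : continuous f -> csupp f ->
  exists M : R, 0 < M /\ forall x, `|f x| <= M.
Proof.
move=> cf /(csupp_ge 1)[N [N1 hN]].
have NN : - N <= N by lra.
have [c _ hc] := @EVT_max R (fun x => `|f x|) (- N) N NN
   (continuous_subspaceT (fun x => cvg_norm (cf x))).
exists (`|f c| + 1); split; first by rewrite ltr_wpDl.
move=> x; have [xN|xN] := leP N `|x|; first by rewrite hN// normr0 ltW// ltr_wpDl.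
apply: (@le_trans _ _ `|f c|); last by rewrite lerDl.
by apply: hc; move: (ltW xN); rewrite ler_norml in_itv.
Qed.

Lemma C0inftyE f : C0infty f <-> smooth f /\ csupp f.
Proof.
split=> [[/smoothE sf cf]|[/smoothE sf [N hN]]]; split=> //.
  have [M [_ hM]] := compact_bounded cf.
  exists (M + 2) => x hx; apply: contrapT => /eqP fx0.
  have : `|x| <= M + 1.
    by apply: (hM (M + 1)); [rewrite ltrDl|exact: subset_closure].
  by move=> ?; lra.
apply: (@subclosed_compact _ _ `[- N, N]); first exact: closed_closure.
  exact: segment_compact.
have /closure_id -> := @interval_closed R (BLeft (- N)) (BRight N) isT isT.
apply: closure_subset => x /= /eqP fx0; rewrite in_itv/= -ler_norml leNgt.
by apply/negP => /ltW/hN.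
Qed.

End smooth_cutoffs.

(** * Gaussian expectations as Lebesgue integrals and as boundary values *)

Section gaussian_integral.
Variable R : realType.
Implicit Types f g : R -> R.
Local Notation mu := (@lebesgue_measure R).
Local Notation gamma := (gaussian R).

Definition rho (x : R) : R := normal_pdf 0 1 x.

Lemma rhoE (x : R) : rho x = normal_peak 1 * expR (- x ^+ 2 / 2).
Proof. by rewrite /rho normal_pdfE ?oner_eq0// /normal_fun subr0 expr1n. Qed.

Lemma rho_gt0 (x : R) : 0 < rho x.
Proof. by rewrite rhoE mulr_gt0 ?expR_gt0// normal_peak_gt0 ?oner_eq0. Qed.

Lemma rho_drv (x : R) : is_derive x 1 rho (- x * rho x).
Proof.
rewrite (_ : rho = fun y => normal_peak 1 * expR (- y ^+ 2 / 2)); last first.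
  by apply/funext => y; rewrite rhoE.
derive_as.
by rewrite /=; field.
Qed.

Lemma rho_cont : continuous rho.
Proof. by move=> x; exact: drv_continuous (rho_drv x). Qed.

(** The Radon-Nikodym derivative of [gamma] and [rho] have the same integral over every measurable
    set, hence agree almost everywhere. *)
Lemma integral_gaussian (f : R -> \bar R) : gamma.-integrable setT f ->
  (\int[gamma]_x f x = \int[mu]_x (f x * (rho x)%:E))%E.
Proof.
move=> fi; have dom := @normal_prob_dominates R 0 1.
rewrite -(@Radon_Nikodym_change_of_variables _ _ _ gamma mu dom)//.
apply: ae_eq_integral => //.
- apply: emeasurable_funM; first exact: measurable_int fi.
  exact: measurable_int (Radon_Nikodym_integrable _).
- apply: emeasurable_funM; first exact: measurable_int fi.
  by apply/measurable_EFinP; exact: measurable_normal_pdf.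
- apply: ae_eqe_mul2l.
  apply: integral_ae_eq => //.
  + exact: Radon_Nikodym_integrable.
  + by apply/measurable_EFinP; exact: measurable_normal_pdf.
  + by move=> A _ mA; rewrite -Radon_Nikodym_integral.
Qed.

Lemma cont_csupp_integrable f : continuous f -> csupp f ->
  mu.-integrable setT (EFin \o f).
Proof.
move=> cf [N hN].
have fN : f \_ `[- N, N] = f.
  apply/funext => x; rewrite patchE; case: ifPn => // /negP; rewrite inE/=.
  rewrite in_itv/= -ler_norml => /negP; rewrite -ltNge => /ltW /hN ->.
  by [].
rewrite -fN -restrict_EFin; apply/integrable_restrict => //.
rewrite setTI; apply: continuous_compact_integrable; first exact: segment_compact.
exact: continuous_subspaceT.
Qed.

(** Integrability allows integration from minus infinity, which gives one primitive on the whole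
    line. *)
Lemma csupp_primitive f : continuous f -> csupp f ->
  exists F : R -> R, forall x : R, is_derive x 1 F (f x).
Proof.
move=> cf sf; exists (fun x => \int[mu]_(t in `]-oo, x]) f t)%R => x.
have xu : x < x + 1 by rewrite ltrDl.
have [] := @continuous_FTC1 R f -oo%O x (x + 1) xu.
- exact: integrableS (cont_csupp_integrable cf sf).
- by rewrite ltNyr.
- exact: cf.
by move=> dF F'; rewrite -F'; exact: derive1_drv.
Qed.

(** Bounded measurable functions form an algebra of integrable functions; linearity of [Eg] then
    needs no separate integrability argument for products and squares. *)
Definition bmfun f := measurable_fun setT f /\ exists M : R, forall x, `|f x| <= M.

Lemma bmfun_integrable f : bmfun f -> gamma.-integrable setT (EFin \o f).
Proof.
move=> [mf [M hM]]; apply: measurable_bounded_integrable => //.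
  by rewrite ltey_eq fin_num_measure.
exists M; split; first exact: num_real.
by move=> M' MM' x _; apply: le_trans (hM x) (ltW MM').
Qed.

Lemma bmfun_cst c : bmfun (fun=> c).
Proof. by split; [exact: measurable_cst|exists `|c|]. Qed.

Lemma bmfunD f g : bmfun f -> bmfun g -> bmfun (fun x => f x + g x).
Proof.
move=> [mf [M hM]] [mg [K hK]]; split; first exact: measurable_funD.
by exists (M + K) => x; apply: le_trans (ler_normD _ _) _; exact: lerD.
Qed.

Lemma bmfunM f g : bmfun f -> bmfun g -> bmfun (fun x => f x * g x).
Proof.
move=> [mf [M hM]] [mg [K hK]]; split; first exact: measurable_funM.
by exists (M * K) => x; rewrite normrM ler_pM.
Qed.

Lemma bmfunN f : bmfun f -> bmfun (fun x => - f x).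
Proof.
move=> bf; rewrite (_ : (fun _ => _) = fun x => -1 * f x).
  by apply: bmfunM => //; exact: bmfun_cst.
by apply/funext => x; rewrite mulN1r.
Qed.

Lemma bmfunB f g : bmfun f -> bmfun g -> bmfun (fun x => f x - g x).
Proof. by move=> ? ?; apply: bmfunD => //; exact: bmfunN. Qed.

Lemma bmfunX f n : bmfun f -> bmfun (fun x => f x ^+ n).
Proof.
move=> bf; elim: n => [|n ih].
  by under eq_fun do rewrite expr0; exact: bmfun_cst.
by under eq_fun do rewrite exprS; exact: bmfunM.
Qed.

Lemma cont_csupp_bmfun f : continuous f -> csupp f -> bmfun f.
Proof.
move=> cf sf; split; first exact: continuous_measurable_fun.
by have [M [_ hM]] := csupp_bounded cf sf; exists M.
Qed.

Definition Eg f : R := \int[gamma]_x f x.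

Lemma EgD f g : bmfun f -> bmfun g -> Eg (fun x => f x + g x) = Eg f + Eg g.
Proof. by move=> bf bg; rewrite /Eg RintegralD//; exact: bmfun_integrable. Qed.

Lemma EgB f g : bmfun f -> bmfun g -> Eg (fun x => f x - g x) = Eg f - Eg g.
Proof. by move=> bf bg; rewrite /Eg RintegralB//; exact: bmfun_integrable. Qed.

Lemma EgZ c f : bmfun f -> Eg (fun x => c * f x) = c * Eg f.
Proof. by move=> bf; rewrite /Eg RintegralZl//; exact: bmfun_integrable. Qed.

Lemma Eg_cst c : Eg (fun=> c) = c.
Proof.
rewrite /Eg Rintegral_cst// -[RHS]mulr1; congr (_ * _).
by rewrite -[RHS]/(fine 1%E); congr fine; exact: (probability_setT gamma).
Qed.

(** This turns expectations into boundary values of a primitive of [f * rho], so that inequalities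
    between expectations become monotonicity statements. *)
Lemma Eg_FTC f F (N : R) : continuous f -> 0 < N ->
  (forall x, N <= `|x| -> f x = 0) ->
  (forall x : R, is_derive x 1 F (f x * rho x)) -> Eg f = F N - F (- N).
Proof.
move=> cf N0 hN dF.
have sf : csupp f by exists N.
rewrite /Eg /Rintegral integral_gaussian; last first.
  exact/bmfun_integrable/cont_csupp_bmfun.
have -> : (fun x => (f x)%:E * (rho x)%:E)%E =
    (fun x => (f x * rho x)%:E) \_ `[- N, N].
  apply/funext => x; rewrite patchE; case: ifPn => [_|]; first by rewrite EFinM.
  move=> /negP; rewrite inE/= in_itv/= -ler_norml => /negP.
  by rewrite -ltNge => /ltW/hN ->; rewrite mul0e.
rewrite -integral_mkcond (@continuous_FTC2 _ _ F)//.
- by lra.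
- apply: continuous_subspaceT => x; apply: cvgM; [exact: cf|exact: rho_cont].
- split.
  + by move=> x _; exact: drv_derivable (dF x).
  + by apply: cvg_at_right_filter; exact: drv_continuous (dF _).
  + by apply: cvg_at_left_filter; exact: drv_continuous (dF _).
- by move=> x _; exact: drv_derive1.
Qed.

End gaussian_integral.

(** * Bounded convergence and cutoffs of growing width *)

Section bounded_convergence.
Variable R : realType.
Implicit Types f g : R -> R.

Lemma Eg_cvg (f_ : nat -> R -> R) f (M : R) :
  (forall n, measurable_fun setT (f_ n)) -> measurable_fun setT f ->
  (forall n x, `|f_ n x| <= M) -> (forall x, f_ n x @[n --> \oo] --> f x) ->
  Eg (f_ n) @[n --> \oo] --> Eg f.
Proof.
move=> mf_ mf hM ff.
have := @dominated_convergence _ _ R (gaussian R) setT measurableT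
  (fun n x => (f_ n x)%:E) (fun x => (f x)%:E) (fun=> M%:E).
case.
- by move=> n; apply/measurable_EFinP; exact (mf_ n).
- exact/measurable_EFinP.
- by apply/aeW => x _; apply: cvg_EFin; [by apply: nearW|exact: ff].
- exact: (bmfun_integrable (bmfun_cst M)).
- by apply/aeW => x n _ /=; rewrite lee_fin.
move=> fi _ cv; apply: fine_cvg.
by rewrite fineK; [exact: cv|exact: integrable_fin_num].
Qed.

(** Width [n.+1] avoids a division by zero at index 0; each derivative gains a factor
    [n.+1%:R^-1]. *)
Definition cutoffn (n : nat) (x : R) : R := cutoff (n.+1%:R^-1 * x).

Lemma cutoffn_ge0 n x : 0 <= cutoffn n x.
Proof. exact: cutoff_ge0. Qed.

Lemma cutoffn_le1 n x : cutoffn n x <= 1.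
Proof. exact: cutoff_le1. Qed.

Lemma cutoffn1 n (x : R) : `|x| <= n.+1%:R -> cutoffn n x = 1.
Proof.
move=> xn; apply: cutoff1; rewrite normrM ger0_norm ?invr_ge0//.
by rewrite ler_pdivrMl ?mulr1.
Qed.

Lemma cutoffn0 n (x : R) : 2 * n.+1%:R <= `|x| -> cutoffn n x = 0.
Proof.
move=> xn; apply: cutoff0; rewrite normrM ger0_norm ?invr_ge0//.
by rewrite ler_pdivlMl// mulrC.
Qed.

Lemma smooth_cutoffn n : smooth (cutoffn n).
Proof.
apply: (@smooth_comp _ (@cutoff R)); first exact: smooth_cutoff.
by apply: smoothM; [exact: smooth_cst|exact: smooth_id].
Qed.

Lemma csupp_cutoffn n : csupp (cutoffn n).
Proof. by exists (2 * n.+1%:R) => x; exact: cutoffn0. Qed.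

Lemma cutoffn_cvg (x : R) : cutoffn n x @[n --> \oo] --> (1 : R).
Proof.
apply: cvg_near_cst; near=> n.
apply: cutoffn1; apply: (@le_trans _ _ n%:R); last by rewrite ler_nat.
by near: n; exact: nbhs_infty_ger.
Unshelve. all: by end_near. Qed.

Lemma bmfun_cutoffn n : bmfun (cutoffn n).
Proof.
by apply: cont_csupp_bmfun; [exact/smooth_cont/smooth_cutoffn|exact: csupp_cutoffn].
Qed.

Lemma Eg_cutoffn_cvg : Eg (cutoffn n) @[n --> \oo] --> (1 : R).
Proof.
rewrite -(Eg_cst (1 : R)); apply: (@Eg_cvg _ _ 1).
- by move=> n; have [] := bmfun_cutoffn n.
- exact: measurable_cst.
- by move=> n x; rewrite ger0_norm ?cutoffn_ge0 ?cutoffn_le1.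
- exact: cutoffn_cvg.
Qed.

End bounded_convergence.

(** * The operator and integration by parts *)

Section weighted_operator.
Variables (R : realType) (b : R).
Hypothesis b_gt0 : 0 < b.
Implicit Types f g : R -> R.

Definition wt (x : R) : R := (1 + b * x ^+ 2)^-1.
Definition dwt (x : R) : R := - (2 * b * x) / (1 + b * x ^+ 2) ^+ 2.

Lemma wt_den_gt0 (x : R) : 0 < 1 + b * x ^+ 2.
Proof. by rewrite ltr_pwDl// mulr_ge0 ?sqr_ge0// ltW. Qed.

Lemma wt_den_neq0 (x : R) : 1 + b * x ^+ 2 != 0.
Proof. by rewrite gt_eqF// wt_den_gt0. Qed.

Lemma wt_gt0 (x : R) : 0 < wt x.
Proof. by rewrite invr_gt0 wt_den_gt0. Qed.

Lemma wt_drv (x : R) : is_derive x 1 wt (dwt x).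
Proof.
have den0 := wt_den_neq0 x.
rewrite /wt /dwt; derive_as; first exact: den0.
by rewrite /=; field.
Qed.

Lemma smooth_wt : smooth wt.
Proof.
apply: smoothV; last exact: wt_den_neq0.
apply: smoothD; first exact: smooth_cst.
by apply: smoothM; [exact: smooth_cst|apply: smoothX; exact: smooth_id].
Qed.

Lemma derive1_wt : derive1 wt = dwt.
Proof. by apply/funext => x; exact: drv_derive1 (wt_drv x). Qed.

Lemma smooth_dwt : smooth dwt.
Proof. by rewrite -derive1_wt; exact/smooth_derive1/smooth_wt. Qed.

(** In divergence form, [A f * rho = - (wt * rho * f')']. It is identified with [- Lop] in
    [minus_Lop]. *)
Definition Aop f (x : R) : R :=
  - (wt x * derive1 (derive1 f) x + (dwt x - x * wt x) * derive1 f x).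

Lemma smooth_Aop f : smooth f -> smooth (Aop f).
Proof.
move=> sf; apply: smoothN; apply: smoothD.
  by apply: smoothM; [exact: smooth_wt|do 2 apply: smooth_derive1].
apply: smoothM; last exact: smooth_derive1.
apply: smoothB; first exact: smooth_dwt.
by apply: smoothM; [exact: smooth_id|exact: smooth_wt].
Qed.

Lemma csupp_Aop f : csupp f -> csupp (Aop f).
Proof.
move=> sf; apply: csuppN; apply: csuppD; apply: csuppMr.
  by do 2 apply: csupp_derive1.
exact: csupp_derive1.
Qed.

(** The difference of the integrands times [rho] is the derivative of [- wt * rho * f' * g], which
    vanishes beyond the support of [f']. Compact support is asked of [f] alone, so [g] may be
    constant: this is how [A f] is seen to have mean zero. *)
Lemma Aop_ibp f g : smooth f -> csupp f -> smooth g ->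
  Eg (fun x => Aop f x * g x) = Eg (fun x => wt x * derive1 f x * derive1 g x).
Proof.
move=> sf cf sg; apply/eqP; rewrite -subr_eq0 -EgB; first last.
- apply: cont_csupp_bmfun.
    apply/smooth_cont/smoothM; last exact: smooth_derive1.
    by apply: smoothM; [exact: smooth_wt|exact: smooth_derive1].
  by apply/csuppMl/csuppMr/csupp_derive1.
- apply: cont_csupp_bmfun; last exact/csuppMl/csupp_Aop.
  by apply/smooth_cont/smoothM => //; exact: smooth_Aop.
have [N [N1 hN]] := csupp_ge 1 (csupp_derive1 cf).
have [M [NM hM]] := csupp_ge N (csupp_derive1 (csupp_derive1 cf)).
have M0 : 0 < M by lra.
have NnM : N <= `|- M| by rewrite normrN gtr0_norm.
have NM' : N <= `|M| by rewrite gtr0_norm.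
pose K x := - (wt x * rho x * derive1 f x * g x).
have dK (x : R) : is_derive x 1 K
    ((Aop f x * g x - wt x * derive1 f x * derive1 g x) * rho x).
  have df := smooth_drv x (smooth_derive1 sf).
  have dg := smooth_drv x sg.
  have dw := wt_drv x; have dr := rho_drv x.
  by rewrite /K; derive_as; rewrite /Aop; ring.
rewrite (Eg_FTC _ M0 _ dK).
- by rewrite /K (hN M)// (hN (- M))// !(mulr0, mul0r) oppr0 subrr.
- apply/smooth_cont/smoothB; apply: smoothM => //; try exact: smooth_Aop.
    by apply: smoothM; [exact: smooth_wt|exact: smooth_derive1].
  exact: smooth_derive1.
- move=> x xM; have xN : N <= `|x| := le_trans NM xM.
  by rewrite /Aop hN// hM// !(mulr0, mul0r, addr0, oppr0).
Qed.

Lemma Eg_Aop f : smooth f -> csupp f -> Eg (Aop f) = 0.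
Proof.
move=> sf cf; have := Aop_ibp sf cf (smooth_cst 1).
rewrite (_ : (fun x => Aop f x * 1) = Aop f); last by apply/funext => x; rewrite mulr1.
move=> ->; rewrite (_ : (fun _ => _) = fun=> 0) ?Eg_cst//.
apply/funext => x; rewrite (_ : derive1 (fun=> 1 : R) x = 0) ?mulr0//.
exact: drv_derive1 (drv_cst _ _).
Qed.

End weighted_operator.

(** * The weighted inequality about [f 0], by comparison with the ground state *)

Section weighted_poincare.
Variables (R : realType) (b a l : R).
Hypotheses (b_gt0 : 0 < b) (a_gt0 : 0 < a) (a_le_b : a <= b) (l_ge0 : 0 <= l)
  (alb : a * (1 - a) = l * b) (la : l <= 1 - a).
Implicit Types f g k : R -> R.
Local Notation wt := (wt b).
Local Notation dwt := (dwt b).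

(* [u = f' x], [v = f x - f 0] and [x^-1 + a x] is the logarithmic derivative of
   the ground state [x expR (a x^2 / 2)]. *)
Lemma ground_state_ineq (x u v s : R) : x != 0 -> 0 <= s <= 1 ->
  dwt x * ((x^-1 + a * x) * v ^+ 2) - x * wt x * ((x^-1 + a * x) * v ^+ 2)
  + wt x * ((- x ^- 2 + a) * v ^+ 2 + (x^-1 + a * x) * (2 * v * u))
  <= wt x * u ^+ 2 - l * (v ^+ 2 * s).
Proof.
move=> x0 /andP[s0 s1]; have den0 := wt_den_gt0 b_gt0 x.
have W0 := wt_gt0 b_gt0 x.
have W1 : wt x * (1 + b * x ^+ 2) = 1 by rewrite mulVf ?gt_eqF.
have -> : dwt x = - (2 * b * x) * wt x ^+ 2 by rewrite /wt exprVn.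
set W := wt x in W0 W1 *.
pose t := x^-1 + a * x.
have tx : t * x = 1 + a * x ^+ 2 by rewrite /t mulrDl mulVf// -mulrA -expr2.
(* Since [a <= b], the quotient [(1 + a x^2) / (1 + b x^2)] is at least [a / b]. *)
have bound : a <= b * W * (1 + a * x ^+ 2).
  rewrite -subr_ge0.
  have -> : b * W * (1 + a * x ^+ 2) - a =
    W * (b - a) + a * (W * (1 + b * x ^+ 2) - 1) by ring.
  by rewrite W1 subrr mulr0 addr0 mulr_ge0 ?subr_ge0// ltW.
rewrite -subr_ge0.
(* The square is completed in [u - t * v]. Of the other summands, the last two vanish by [W1] and
   [alb], and the one before them is nonnegative by [bound] and [la]. *)
have -> : W * u ^+ 2 - l * (v ^+ 2 * s) -
   (- (2 * b * x) * W ^+ 2 * ((x^-1 + a * x) * v ^+ 2) -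
    x * W * ((x^-1 + a * x) * v ^+ 2) +
    W * ((- x ^- 2 + a) * v ^+ 2 + (x^-1 + a * x) * (2 * v * u))) =
   W * (u - t * v) ^+ 2 + l * (v ^+ 2 * (1 - s)) +
   W * v ^+ 2 * (1 - a - l + 2 * (b * W * (1 + a * x ^+ 2) - a))
   + (l - l * (W * (1 + b * x ^+ 2))) * (- v ^+ 2) +
   W * v ^+ 2 * x ^+ 2 * (a * (1 - a) - l * b).
  by rewrite /t; field.
rewrite W1 mulr1 subrr mul0r alb subrr mulr0 !addr0.
apply: addr_ge0; first apply: addr_ge0.
- by rewrite mulr_ge0 ?sqr_ge0// ltW.
- by do 2 rewrite mulr_ge0 ?sqr_ge0// ?subr_ge0//.
- apply: mulr_ge0; first by rewrite mulr_ge0 ?sqr_ge0// ltW.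
  by have := la; lra.
Qed.

(** The factor [k] gives [(f - f 0)^2], which tends to [f 0 ^ 2] at infinity, a compact support, so
    that [Eg_FTC] applies; it costs nothing as [k <= 1]. With [P] a primitive of the difference of
    the two integrands times [rho], and [G] the weighted logarithmic derivative of the ground state
    times [(f - f 0)^2], [ground_state_ineq] makes [P - G] nondecreasing on each half-line. *)
Lemma poincare_cut f k : smooth f -> csupp f -> continuous k -> csupp k ->
  (forall x, 0 <= k x <= 1) ->
  l * Eg (fun x => (f x - f 0) ^+ 2 * k x)
  <= Eg (fun x => wt x * derive1 f x ^+ 2).
Proof.
move=> sf cf kc ks k01.
pose g x := f x - f 0.
pose h x := wt x * derive1 f x ^+ 2 - l * (g x ^+ 2 * k x).
have sg : smooth g by apply: smoothB => //; exact: smooth_cst.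
have c1 : continuous (fun x => wt x * derive1 f x ^+ 2).
  apply/smooth_cont/smoothM; first exact: smooth_wt.
  exact/smoothX/smooth_derive1.
have s1 : csupp (fun x => wt x * derive1 f x ^+ 2).
  by apply/csuppMr; under eq_fun do rewrite expr2; exact/csuppMr/csupp_derive1.
have c2 : continuous (fun x => g x ^+ 2 * k x).
  move=> x; apply: cvgM; last exact: kc.
  exact: (smooth_cont (smoothX 2 sg)).
have s2 : csupp (fun x => g x ^+ 2 * k x) by exact: csuppMr.
have hc : continuous h.
  by move=> x; apply: cvgB; [exact: c1|apply: cvgM; [exact: cvg_cst|exact: c2]].
have hs : csupp h by apply: csuppB => //; exact: csuppMr.
rewrite -subr_ge0 -EgZ; last exact: cont_csupp_bmfun.
rewrite -EgB; first last.
- by apply: bmfunM; [exact: bmfun_cst|exact: cont_csupp_bmfun].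
- exact: cont_csupp_bmfun.
rewrite -/h.
have [P dP] : exists P : R -> R, forall x : R, is_derive x 1 P (h x * rho x).
  apply: csupp_primitive; last exact: csuppMl.
  by move=> x; apply: cvgM; [exact: hc|exact: rho_cont].
have [N [N1 hN]] := csupp_ge 1 hs.
have N0 : 0 < N by lra.
rewrite (Eg_FTC hc N0 hN dP).
pose G x := wt x * rho x * ((x^-1 + a * x) * g x ^+ 2).
have dG (x : R) : x != 0 -> exists2 c : R, c <= h x * rho x & is_derive x 1 G c.
  move=> x0; pose u := derive1 f x.
  exists ((dwt x * ((x^-1 + a * x) * g x ^+ 2) -
           x * wt x * ((x^-1 + a * x) * g x ^+ 2)
  + wt x * ((- x ^- 2 + a) * g x ^+ 2 + (x^-1 + a * x) * (2 * g x * u))) * rho x).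
    by rewrite ler_pM2r ?rho_gt0//; exact: ground_state_ineq.
  have df : is_derive x 1 g u.
    rewrite /g; derive_as; first exact: smooth_drv.
    by rewrite subr0.
  have dw := wt_drv b_gt0 x; have dr := rho_drv x.
  rewrite /G; derive_as; first exact: x0.
  by rewrite /=; field.
pose D x := P x - G x.
have dD (x : R) : x != 0 -> exists2 c : R, 0 <= c & is_derive x 1 D c.
  move=> /dG[c ch Gc]; exists (h x * rho x - c); first by rewrite subr_ge0.
  by apply: drvB.
(* The two half-lines are joined at 0: the singular part of [G] is [g^2 / x], which is [g] times the
   difference quotient [q] of [f] at 0, and [g 0 = 0]. *)
have Dc : continuous D.
  move=> x; have [->|x0] := eqVneq x 0; last first.
    by have [c _ dc] := dD x x0; exact: drv_continuous dc.
  have /is_derive1_caratheodory[q [qE qc _]] := smooth_drv 0 sf.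
  rewrite (_ : D = fun y => P y - wt y * rho y * (g y * q y + a * y * g y ^+ 2)).
    apply: cvgB; first exact: drv_continuous (dP 0).
    apply: cvgM; first apply: cvgM.
    - exact: drv_continuous (wt_drv b_gt0 0).
    - exact: rho_cont.
    apply: cvgD; apply: cvgM.
    - exact: smooth_cont.
    - exact: qc.
    - by apply: cvgM; [exact: cvg_cst|exact: cvg_id].
    - exact: (smooth_cont (smoothX 2 sg)).
  apply/funext => y; rewrite /D /G; congr (_ - _ * _).
  have [->|y0] := eqVneq y 0; first by rewrite /g subrr expr0n/= !(mulr0, mul0r) addr0.
  have -> : q y = g y / y by rewrite /g qE subr0 mulfK.
  by field.
have mono x y : x <= y -> (0 <= x \/ y <= 0) -> D x <= D y.
  move=> xy xy0.
  have nz z : z \in `]x, y[ -> z != 0.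
    rewrite in_itv/= => /andP[xz zy]; apply/eqP => z0.
    by case: xy0; lra.
  apply: (@ger0_derive1_le_cc _ D x y) => //.
  - by move=> z /nz/dD[c _ dc]; exact: drv_derivable dc.
  - by move=> z /nz/dD[c c0 dc]; rewrite (drv_derive1 dc).
  - exact: continuous_subspaceT.
  - by rewrite in_itv/= lexx.
  - by rewrite in_itv/= xy lexx.
have D1 : D (- N) <= D 0 by apply: mono; [lra|right].
have D2 : D 0 <= D N by apply: mono; [lra|left].
have WR (x : R) : 0 <= wt x * rho x.
  by rewrite mulr_ge0// ltW// ?rho_gt0// wt_gt0.
(* The factor [x^-1 + a x] is odd, so the boundary terms of [G] have the favourable sign at both
   ends and no decay is required. *)
have TN : 0 <= N^-1 + a * N by rewrite addr_ge0 ?mulr_ge0 ?invr_ge0// ltW.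
have GN : 0 <= G N by apply: mulr_ge0 => //; apply: mulr_ge0 => //; exact: sqr_ge0.
have GnN : G (- N) <= 0.
  rewrite /G invrN mulrN -opprD mulNr mulrN oppr_le0.
  by apply: mulr_ge0 => //; apply: mulr_ge0 => //; exact: sqr_ge0.
move: (le_trans D1 D2); rewrite /D => h4; lra.
Qed.

(** The cutoff factor is removed by bounded convergence along [cutoffn]. *)
Lemma poincare f : smooth f -> csupp f ->
  l * Eg (fun x => (f x - f 0) ^+ 2) <= Eg (fun x => wt x * derive1 f x ^+ 2).
Proof.
move=> sf cf.
have bg : bmfun (fun x => (f x - f 0) ^+ 2).
  apply/bmfunX/bmfunB; last exact: bmfun_cst.
  by apply: cont_csupp_bmfun => //; exact: smooth_cont.
have cv : Eg (fun x => (f x - f 0) ^+ 2 * cutoffn n x) @[n --> \oo]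
    --> Eg (fun x => (f x - f 0) ^+ 2).
  have [mg [M hM]] := bg; apply: (@Eg_cvg _ _ _ M).
  - by move=> n; have [] := bmfunM bg (@bmfun_cutoffn R n).
  - exact: mg.
  - move=> n x; rewrite normrM -[M]mulr1 ler_pM//.
    by rewrite ger0_norm ?cutoffn_ge0 ?cutoffn_le1.
  - move=> x; rewrite -[X in _ --> X]mulr1; apply: cvgM; first exact: cvg_cst.
    exact: cutoffn_cvg.
apply: (cvgr_to_le (cvgM (cvg_cst l) cv)); apply: nearW => n.
apply: poincare_cut => //.
- exact/smooth_cont/smooth_cutoffn.
- exact: csupp_cutoffn.
- by move=> x; rewrite cutoffn_ge0 cutoffn_le1.
Qed.

End weighted_poincare.

(** * Square-integrable functions over a probability *)

Section square_integrable.
Context d (T : measurableType d) (R : realType) (P : probability T R).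
Implicit Types f g h : T -> R.

Definition L2 f : Prop := f \in Lfun P 2%:E.

(** A real number, so that estimates stay in [R]; it agrees with [L2norm] on square-integrable
    functions by [L2normE]. *)
Definition nrm f : R := Num.sqrt (\int[P]_x (f x ^+ 2)).

Lemma L2P f : L2 f <-> measurable_fun setT f /\
  P.-integrable setT (EFin \o (fun x => f x ^+ 2)).
Proof.
split=> [l2f|[mf /integrableP[_ fi]]].
  split; last exact: Lfun2_integrable_sqr.
  by move: l2f; rewrite /L2 inE => /andP[+ _]; rewrite inE.
rewrite /L2 inE; apply/andP; split; first by rewrite inE.
rewrite inE /= /finite_norm unlock poweR_lty//.
apply: le_lt_trans fi; rewrite le_eqVlt; apply/orP; left; apply/eqP.
apply: eq_integral => x _ /=.
by rewrite normrX powR_mulrn.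
Qed.

Lemma L2_measurable f : L2 f -> measurable_fun setT f.
Proof. by move=> /L2P[]. Qed.

Lemma L2_sqr_integrable f : L2 f ->
  P.-integrable setT (EFin \o (fun x => f x ^+ 2)).
Proof. by move=> /L2P[]. Qed.

Lemma L2_mul_integrable f g : L2 f -> L2 g ->
  P.-integrable setT (EFin \o (fun x => f x * g x)).
Proof. by move=> l2f l2g; apply/Lfun1_integrable; exact: Lfun2_mul_Lfun1. Qed.

Lemma nrm_ge0 f : 0 <= nrm f.
Proof. exact: sqrtr_ge0. Qed.

Lemma nrm_sqr f : nrm f ^+ 2 = \int[P]_x (f x ^+ 2).
Proof. by rewrite sqr_sqrtr// Rintegral_ge0// => x _; exact: sqr_ge0. Qed.

Lemma L2normE f : L2 f -> L2norm P f = (nrm f)%:E.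
Proof.
move=> l2f; have fi := L2_sqr_integrable l2f.
have /fineK : (L2norm P f \is a fin_num).
  rewrite ge0_fin_numE ?Lnorm_ge0//.
  by move: l2f; rewrite /L2 inE => /andP[_]; rewrite inE.
have n0 : 0 <= fine (L2norm P f) by rewrite fine_ge0// Lnorm_ge0.
set r := fine _ in n0 * => rE; rewrite -rE; congr EFin.
rewrite /nrm -[LHS](ger0_norm n0) -sqrtr_sqr; congr Num.sqrt.
have e : (L2norm P f `^ 2 = \int[P]_x (f x ^+ 2)%:E)%E.
  rewrite /L2norm poweR_Lnorm//; apply: eq_integral => x _ /=.
  by rewrite powR_mulrn// real_normK ?num_real.
by rewrite /Rintegral -e -rE /= powR_mulrn.
Qed.

Lemma L2_cst c : L2 (fun=> c).
Proof. exact: Lfun_cst. Qed.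

Lemma L2M_integrable c f g : L2 f -> L2 g ->
  P.-integrable setT (EFin \o (fun x => c * (f x * g x))).
Proof.
move=> l2f l2g; rewrite (_ : _ \o _ = fun x => (c%:E * (f x * g x)%:E)%E) //.
by apply: integrableZl => //; exact: L2_mul_integrable.
Qed.

Lemma integrable_addr f g : P.-integrable setT (EFin \o f) ->
  P.-integrable setT (EFin \o g) ->
  P.-integrable setT (EFin \o (fun x => f x + g x)).
Proof.
move=> fi gi; rewrite (_ : _ \o _ = (EFin \o f) \+ (EFin \o g))%E //.
exact: integrableD.
Qed.

Lemma L2D f g : L2 f -> L2 g -> L2 (fun x => f x + g x).
Proof.
move=> l2f l2g; apply/L2P; split.
  by apply: measurable_funD; exact: L2_measurable.
rewrite (_ : (fun x => (f x + g x) ^+ 2) =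
  fun x => f x ^+ 2 + 2 * (f x * g x) + g x ^+ 2); last first.
  by apply/funext => x; ring.
apply: integrable_addr; last exact: L2_sqr_integrable.
apply: integrable_addr; first exact: L2_sqr_integrable.
exact: L2M_integrable.
Qed.

Lemma L2Z c f : L2 f -> L2 (fun x => c * f x).
Proof.
move=> l2f; apply/L2P; split.
  by apply: measurable_funM => //; exact: L2_measurable.
rewrite (_ : (fun x => (c * f x) ^+ 2) = fun x => c ^+ 2 * (f x * f x)).
  exact: L2M_integrable.
by apply/funext => x; ring.
Qed.

Lemma L2B f g : L2 f -> L2 g -> L2 (fun x => f x - g x).
Proof.
move=> l2f l2g; under eq_fun do rewrite -mulN1r.
by apply: L2D => //; exact: L2Z.
Qed.

Lemma nrmD f g : L2 f -> L2 g -> nrm (fun x => f x + g x) <= nrm f + nrm g.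
Proof.
move=> l2f l2g; rewrite -lee_fin EFinD -!L2normE//; last exact: L2D.
by apply: (@minkowski_EFin _ _ _ P f g 2); rewrite ?ler1n//; exact: L2_measurable.
Qed.

Lemma nrmZ c f : L2 f -> nrm (fun x => c * f x) = `|c| * nrm f.
Proof.
move=> l2f; rewrite /nrm -sqrtr_sqr -sqrtrM ?sqr_ge0//; congr Num.sqrt.
rewrite -RintegralZl//; last exact: L2_sqr_integrable.
by apply: eq_Rintegral => x _; rewrite exprMn.
Qed.

Lemma nrmN f : nrm (fun x => - f x) = nrm f.
Proof. by rewrite /nrm; congr Num.sqrt; apply: eq_Rintegral => x _; rewrite sqrrN. Qed.

Lemma nrmB_sym f g : nrm (fun x => f x - g x) = nrm (fun x => g x - f x).
Proof. by rewrite -nrmN; under eq_fun do rewrite opprB. Qed.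

Lemma nrmB f g : L2 f -> L2 g -> nrm (fun x => f x - g x) <= nrm f + nrm g.
Proof.
move=> l2f l2g; rewrite -(nrmN g); apply: nrmD => //.
by under eq_fun do rewrite -mulN1r; exact: L2Z.
Qed.

Lemma nrm_triangle h f g : L2 f -> L2 g -> L2 h ->
  nrm (fun x => f x - g x) <= nrm (fun x => f x - h x) + nrm (fun x => h x - g x).
Proof.
move=> l2f l2g l2h.
have := nrmD (L2B l2f l2h) (L2B l2h l2g).
by under eq_fun do rewrite addrA subrK.
Qed.

Lemma nrm_cst c : nrm (fun=> c) = `|c|.
Proof.
rewrite /nrm -sqrtr_sqr; congr Num.sqrt; rewrite Rintegral_cst//.
rewrite -[RHS]mulr1; congr (_ * _).
by rewrite -[RHS]/(fine 1%E); congr fine; exact: (probability_setT P).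
Qed.

Lemma L2_le f g : measurable_fun setT f -> L2 g -> (forall x, `|f x| <= `|g x|) ->
  L2 f.
Proof.
move=> mf l2g fg; apply/L2P; split=> //.
apply: (le_integrable measurableT _ _ (L2_sqr_integrable l2g)).
  by apply/measurable_EFinP; exact: measurable_funX.
move=> x _ /=; rewrite lee_fin !ger0_norm ?sqr_ge0//.
by rewrite -(real_normK (num_real (f x))) -(real_normK (num_real (g x))) lerXn2r ?nnegrE.
Qed.

Lemma nrm_le f g : L2 f -> L2 g -> (forall x, `|f x| <= `|g x|) -> nrm f <= nrm g.
Proof.
move=> l2f l2g fg; rewrite /nrm ler_sqrt; last first.
  by apply: Rintegral_ge0 => x _; exact: sqr_ge0.
apply: le_Rintegral => //; [exact: L2_sqr_integrable..|].
move=> x _; rewrite -(real_normK (num_real (f x))) -(real_normK (num_real (g x))).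
by rewrite lerXn2r ?nnegrE.
Qed.

Lemma nrm_le_cst f (M : R) : L2 f -> (forall x, `|f x| <= M) -> nrm f <= `|M|.
Proof.
move=> l2f fM; rewrite -(nrm_cst M); apply: nrm_le => //; first exact: L2_cst.
by move=> x; exact: le_trans (fM x) (ler_norm _).
Qed.

(** The quadratic form given by the squared norm of [s f + t g] is nonnegative; its value at
    [s = B], [t = - C] is [B (A B - C^2)]. *)
Lemma cauchy_schwarz f g : L2 f -> L2 g ->
  `|\int[P]_x (f x * g x)| <= nrm f * nrm g.
Proof.
move=> l2f l2g.
rewrite -ler_sqr ?nnegrE ?mulr_ge0 ?nrm_ge0// real_normK ?num_real//.
rewrite exprMn !nrm_sqr.
set A := \int[P]_x (f x ^+ 2); set B := \int[P]_x (g x ^+ 2).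
set C := \int[P]_x (f x * g x).
have quad (s t : R) : 0 <= s ^+ 2 * A + 2 * s * t * C + t ^+ 2 * B.
  have := nrm_sqr (fun x => s * f x + t * g x).
  have -> : \int[P]_x ((s * f x + t * g x) ^+ 2) =
      s ^+ 2 * A + 2 * s * t * C + t ^+ 2 * B.
    have f2 : P.-integrable setT (EFin \o (fun x => s ^+ 2 * f x ^+ 2)).
      rewrite (_ : (fun x => _) = fun x => s ^+ 2 * (f x * f x)); last first.
        by apply/funext => x; rewrite expr2.
      exact: L2M_integrable.
    have g2 : P.-integrable setT (EFin \o (fun x => t ^+ 2 * g x ^+ 2)).
      rewrite (_ : (fun x => _) = fun x => t ^+ 2 * (g x * g x)); last first.
        by apply/funext => x; rewrite [g x ^+ 2]expr2.
      exact: L2M_integrable.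
    have fg : P.-integrable setT (EFin \o (fun x => 2 * s * t * (f x * g x))).
      exact: L2M_integrable.
    rewrite /A /B /C -!RintegralZl//; try exact: L2_sqr_integrable.
      rewrite -RintegralD// -RintegralD//; last exact: integrable_addr.
      by apply: eq_Rintegral => x _; ring.
    exact: L2_mul_integrable.
  by move=> <-; exact: sqr_ge0.
have A0 : 0 <= A by rewrite /A -nrm_sqr sqr_ge0.
have B0 : 0 <= B by rewrite /B -nrm_sqr sqr_ge0.
have [B_eq0|B_neq0] := eqVneq B 0.
  have [->|C_neq0] := eqVneq C 0; first by rewrite expr0n/= mulr_ge0.
  (* With [B = 0] the form is affine in [t], and this [t] would give it the value -1. *)
  have := quad 1 (- (A + 1) / (2 * C)).
  rewrite B_eq0 mulr0 addr0 expr1n mul1r mulr1.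
  have -> : 2 * (- (A + 1) / (2 * C)) * C = - (A + 1) by field.
  by move=> h; exfalso; lra.
have Bgt0 : 0 < B by rewrite lt_def B_neq0.
have := quad B (- C).
have -> : B ^+ 2 * A + 2 * B * - C * C + (- C) ^+ 2 * B = B * (A * B - C ^+ 2) by ring.
by rewrite pmulr_rge0// subr_ge0.
Qed.

End square_integrable.

(** * Completeness of L^2 *)

Section completeness.
Context d (T : measurableType d) (R : realType) (P : probability T R).
Implicit Types f g h : T -> R.

Lemma fatou_le (F_ : nat -> T -> R) (F : T -> R) (c : \bar R) :
  (forall n, measurable_fun setT (F_ n)) -> (forall n x, 0 <= F_ n x) ->
  (forall x, F_ n x @[n --> \oo] --> F x) ->
  (\forall n \near \oo, \int[P]_x (F_ n x)%:E <= c)%E ->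
  (\int[P]_x (F x)%:E <= c)%E.
Proof.
move=> mF F0 FF [N _ hN].
have -> : (\int[P]_x (F x)%:E = \int[P]_x limn_einf (fun n => (F_ n x)%:E))%E.
  apply: eq_integral => x _.
  have cv : (F_ n x)%:E @[n --> \oo] --> (F x)%:E.
    by apply: cvg_EFin; [apply: nearW|exact: FF].
  by rewrite is_cvg_limn_einfE; [apply/esym/cvg_lim|apply/cvg_ex; exists (F x)%:E].
apply: le_trans (fatou P measurableT _ _) _.
- by move=> n; apply/measurable_EFinP; exact (mF n).
- by move=> n x _; rewrite lee_fin.
rewrite limn_einf_lim; apply: lime_le; first exact: is_cvg_einfs.
(* The infimum over the tail from [n] on is at most the term of index [maxn n N], which already
   satisfies the bound. *)
apply: nearW => n; apply: (@le_trans _ _ (\int[P]_x (F_ (maxn n N) x)%:E)%E).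
  by apply: ereal_inf_lbound; exists (maxn n N) => //=; exact: leq_maxl.
by apply: hN => /=; exact: leq_maxr.
Qed.

(** Riesz-Fischer: a subsequence with summable increments converges almost everywhere, and Fatou's
    lemma turns this into convergence in norm. *)
Lemma L2_complete (u : nat -> T -> R) : (forall n, L2 P (u n)) ->
  (forall e, 0 < e -> exists N, forall n m, (N <= n)%N -> (N <= m)%N ->
    nrm P (fun x => u n x - u m x) <= e) ->
  exists f, L2 P f /\
    (forall e, 0 < e -> exists N, forall n, (N <= n)%N ->
      nrm P (fun x => f x - u n x) <= e).
Proof.
move=> l2u cu.
have e2_gt0 k : 0 < 1 / (2 ^ k.+1)%:R :> R by rewrite divr_gt0// ltr0n expn_gt0.
have [phi hphi] := choice (fun k => cu _ (e2_gt0 k)).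
(* A sum instead of [phi k] itself: it dominates every [phi j] with [j <= k], so the Cauchy bound of
   level [k] holds for all later indices. *)
pose psi k := (\sum_(i < k.+1) phi i)%N.
have psi_phi k j : (k <= j)%N -> (phi k <= psi j)%N.
  move=> kj; rewrite /psi.
  have lt_kj : (k < j.+1)%N by rewrite ltnS.
  by rewrite (bigD1 (Ordinal lt_kj))//= leq_addr.
pose v k := u (psi k).
have l2v k : L2 P (v k) by exact: l2u.
have mv k := L2_measurable (l2v k).
have vv k i j : (k <= i)%N -> (k <= j)%N ->
    nrm P (fun x => v i x - v j x) <= 1 / (2 ^ k.+1)%:R.
  by move=> ki kj; apply: hphi; exact: psi_phi.
pose g k x : R := `|v k.+1 x - v k x|.
have g0 k x : 0 <= g k x by exact: normr_ge0.
have mg k : measurable_fun setT (g k).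
  by apply: measurableT_comp => //; exact: measurable_funB.
(* Cauchy-Schwarz against the constant 1, which has norm 1 for a probability. *)
have gint k : (\int[P]_x (g k x)%:E <= (1 / (2 ^ k.+1)%:R)%:E)%E.
  have l2d : L2 P (fun x => v k.+1 x - v k x) by exact: L2B.
  have l2g : L2 P (g k).
    by apply: (L2_le (mg k) l2d) => x; rewrite normr_id.
  have := cauchy_schwarz l2g (L2_cst P 1).
  rewrite nrm_cst normr1 mulr1; under eq_Rintegral do rewrite mulr1.
  have gi : P.-integrable setT (EFin \o g k).
    rewrite (_ : g k = fun x => g k x * 1); last by apply/funext => x; rewrite mulr1.
    exact: (L2_mul_integrable l2g (L2_cst P 1)).
  move=> h; rewrite -[leLHS]fineK; last exact: (integrable_fin_num measurableT gi).
  rewrite lee_fin; apply: le_trans (ler_norm _) (le_trans h _).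
  apply: le_trans (vv k k.+1 k (leqnSn k) (leqnn k)).
  by apply: nrm_le => // x; rewrite normr_id.
pose S x := (\sum_(k <oo) (g k x)%:E)%E.
have mS : measurable_fun setT S.
  apply: ge0_emeasurable_sum => [k x _ _|k _]; first by rewrite lee_fin.
  by apply/measurable_EFinP; exact (mg k).
have intS : (\int[P]_x S x <= 1)%E.
  rewrite integral_nneseries//; last 2 first.
    by move=> k; apply/measurable_EFinP; exact (mg k).
    by move=> k x _; rewrite lee_fin.
  apply: (@le_trans _ _ (\sum_(k <oo) (1 / (2 ^ k.+1)%:R)%:E)%E).
    apply: lee_nneseries => // k _ _; apply: integral_ge0 => x _.
    by rewrite lee_fin.
  exact: epsilon_trick0.
have S0 x : (0 <= S x)%E by apply: nneseries_ge0 => *; rewrite lee_fin.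
have iS : P.-integrable setT S.
  apply/integrableP; split=> //; under eq_integral do rewrite gee0_abs//.
  by apply: le_lt_trans intS _; rewrite ltry.
have Sfin := integrable_ae measurableT iS.
pose D := [set x | (S x < +oo)%E].
have mD : measurable D by rewrite -[D]setTI; exact: emeasurable_fun_infty_o.
have vcv x : D x -> cvgn (fun n => v n x).
  move=> Dx.
  have cs : cvgn (series (fun k => v k.+1 x - v k x)).
    apply: normed_cvg; apply: nondecreasing_is_cvgn.
      apply/nondecreasing_seqP => n; rewrite /= /series/= big_nat_recr//=.
      by rewrite lerDl.
    exists (fine (S x)) => _ [n _ <-] /=.
    rewrite -lee_fin fineK ?ge0_fin_numE// /series/= -sumEFin.
    exact: nneseries_lim_ge.
  rewrite (_ : (fun n => v n x) = fun n => v 0 x + series (fun k => v k.+1 x - v k x) n).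
    by apply: is_cvgD => //; exact: is_cvg_cst.
  apply/funext => n; rewrite /series/= telescope_sumr//.
  by rewrite addrC subrK.
(* Multiplied by the indicator of the convergence set, the sequence converges at every point, which
   makes the limit measurable. *)
pose w k x := v k x * \1_D x.
have mw k : measurable_fun setT (w k) by apply: measurable_funM.
pose f x := limn (fun k => w k x).
have wf x : w k x @[k --> \oo] --> f x.
  rewrite /f /w; have [Dx|nDx] := pselect (D x).
    by apply: is_cvgMl; exact: vcv.
  by rewrite indicE memNset//; under eq_fun do rewrite mulr0; exact: is_cvg_cst.
have mf : measurable_fun setT f.
  apply/measurable_EFinP; apply: (emeasurable_fun_cvg (fun k x => (w k x)%:E)).
    by move=> k; apply/measurable_EFinP; exact (mw k).
  by move=> x _; apply: cvg_EFin; [apply: nearW|exact: wf].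
(* Fatou's lemma in [j] with [k] fixed; [w j] may be replaced by [v j] because [D] has full
   measure. *)
have fv k : (\int[P]_x ((f x - v k x) ^+ 2)%:E <= ((1 / (2 ^ k.+1)%:R) ^+ 2)%:E)%E.
  apply: (@fatou_le (fun j x => (w j x - v k x) ^+ 2)).
  - by move=> j; apply: measurable_funX; exact: measurable_funB.
  - by move=> j x; exact: sqr_ge0.
  - move=> x; apply: (@cvg_comp _ _ _ (fun j => w j x - v k x) (fun y => y ^+ 2)).
      by apply: cvgB; [exact: wf|exact: cvg_cst].
    exact: sqr_continuous.
  exists k => // j /= kj.
  have -> : (\int[P]_x ((w j x - v k x) ^+ 2)%:E =
      \int[P]_x ((v j x - v k x) ^+ 2)%:E)%E.
    apply: ge0_ae_eq_integral => //.
    - by apply/measurable_EFinP/measurable_funX; exact: measurable_funB.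
    - by apply/measurable_EFinP/measurable_funX; exact: measurable_funB.
    - by move=> x _; rewrite lee_fin sqr_ge0.
    - by move=> x _; rewrite lee_fin sqr_ge0.
    apply: filterS Sfin => x /(_ I) Sx _.
    by rewrite /w indicE mem_set ?mulr1//= /D/= -ge0_fin_numE.
  have l2d : L2 P (fun x => v j x - v k x) by exact: L2B.
  have := L2_sqr_integrable l2d => /(integrable_fin_num measurableT)/fineK <-.
  rewrite lee_fin -[leLHS]/(\int[P]_x ((v j x - v k x) ^+ 2)) -nrm_sqr.
  by rewrite lerXn2r ?nnegrE ?nrm_ge0 ?vv// ltW.
have l2fv k : L2 P (fun x => f x - v k x).
  apply/L2P; split; first exact: measurable_funB.
  apply/integrableP; split.
    by apply/measurable_EFinP/measurable_funX; exact: measurable_funB.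
  under eq_integral do rewrite /= ger0_norm ?sqr_ge0//.
  by apply: le_lt_trans (fv k) _; rewrite ltry.
have nfv k : nrm P (fun x => f x - v k x) <= 1 / (2 ^ k.+1)%:R.
  rewrite -ler_sqr ?nnegrE ?nrm_ge0 ?(ltW (e2_gt0 k))// nrm_sqr.
  rewrite -lee_fin /Rintegral fineK; first exact: fv.
  exact: (integrable_fin_num measurableT (L2_sqr_integrable (l2fv k))).
have l2f : L2 P f.
  have := L2D (l2fv 0) (l2v 0).
  by under eq_fun do rewrite subrK.
exists f; split=> // e e0.
have [k ke] : exists k, 1 / (2 ^ k.+1)%:R <= e / 2.
  have [k _ hk] := near_infty_natSinv_expn_lt (PosNum (divr_gt0 e0 (ltr0n R 2))).
  by exists k; rewrite natrX ltW//; apply: hk => /=.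
exists (phi k) => n kn.
apply: le_trans (nrm_triangle l2f (l2u n) (l2v k)) _.
rewrite [e]splitr; apply: lerD; apply: le_trans ke; first exact: nfv.
by apply: hphi => //; exact: psi_phi.
Qed.

End completeness.

(** * Density in L^2, reduced to indicators *)

Section density.
Context d (T : measurableType d) (R : realType) (P : probability T R).
Implicit Types f g h : T -> R.

Lemma L2_dominated (h_ : nat -> T -> R) h g (e : R) :
  (forall n, L2 P (h_ n)) -> L2 P h -> L2 P g ->
  (forall n x, `|h x - h_ n x| <= g x) ->
  (forall x, h_ n x @[n --> \oo] --> h x) -> 0 < e ->
  exists n, nrm P (fun x => h x - h_ n x) <= e.
Proof.
move=> l2h_ l2h l2g hg hh e0.
have l2d n : L2 P (fun x => h x - h_ n x) by exact: L2B.
have := @dominated_convergence _ _ R P setT measurableT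
  (fun n x => ((h x - h_ n x) ^+ 2)%:E) (fun=> 0%E) (fun x => (g x ^+ 2)%:E).
case.
- move=> n; apply/measurable_EFinP; apply: measurable_funX.
  exact: (L2_measurable (l2d n)).
- exact: measurable_cst.
- apply/aeW => x _; apply: cvg_EFin; first by apply: nearW.
  rewrite (_ : 0 = (h x - h x) ^+ 2); last by rewrite subrr expr0n.
  apply: (@cvg_comp _ _ _ (fun n => h x - h_ n x) (fun y => y ^+ 2)).
    by apply: cvgB; [exact: cvg_cst|exact: hh].
  exact: sqr_continuous.
- exact: L2_sqr_integrable.
- apply/aeW => x n _ /=; rewrite lee_fin normrX lerXn2r ?nnegrE//.
  exact: le_trans (hg n x).
move=> _ _; rewrite integral0 => cv.
have /fine_cvg/cvgrPdist_le/(_ (e ^+ 2) (exprn_gt0 2 e0))[n _ hn] := cv.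
exists n; rewrite -ler_sqr ?nnegrE ?nrm_ge0 ?(ltW e0)// nrm_sqr.
have := hn n (leqnn n); rewrite /= sub0r normrN.
exact: le_trans (ler_norm _).
Qed.

Variable C : (T -> R) -> Prop.
Hypotheses (C_L2 : forall f, C f -> L2 P f) (C0 : C (fun=> 0))
  (CD : forall f g, C f -> C g -> C (fun x => f x + g x))
  (CZ : forall c f, C f -> C (fun x => c * f x)).

(** Membership in the L^2-closure of the linear class [C]. *)
Definition approx_by h := L2 P h /\
  forall e : R, 0 < e -> exists2 g, C g & nrm P (fun x => h x - g x) <= e.

Lemma approx_by_lim h : L2 P h ->
  (forall e : R, 0 < e ->
    exists2 g, approx_by g & nrm P (fun x => h x - g x) <= e) -> approx_by h.
Proof.
move=> l2h hh; split=> // e e0.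
have e20 : 0 < e / 2 by rewrite divr_gt0.
have [g [l2g gC] hg] := hh _ e20.
have [k Ck gk] := gC _ e20.
exists k => //; apply: le_trans (nrm_triangle l2h (C_L2 Ck) l2g) _.
by rewrite [e]splitr lerD.
Qed.

Lemma approx_byC f : C f -> approx_by f.
Proof.
move=> Cf; split=> [|e e0]; first exact: C_L2.
exists f => //; under eq_fun do rewrite subrr.
by rewrite nrm_cst normr0 ltW.
Qed.

Lemma approx_byD f g : approx_by f -> approx_by g ->
  approx_by (fun x => f x + g x).
Proof.
move=> [l2f af] [l2g ag]; split=> [|e e0]; first exact: L2D.
have e20 : 0 < e / 2 by rewrite divr_gt0.
have [f' Cf' ff'] := af _ e20.
have [g' Cg' gg'] := ag _ e20.
exists (fun x => f' x + g' x); first exact: CD.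
have := nrmD (L2B l2f (C_L2 Cf')) (L2B l2g (C_L2 Cg')).
under eq_fun do rewrite addrACA -opprD.
by move=> /le_trans; apply; rewrite [e]splitr lerD.
Qed.

Lemma approx_byZ c f : approx_by f -> approx_by (fun x => c * f x).
Proof.
move=> [l2f af]; split=> [|e e0]; first exact: L2Z.
have c0 : 0 < `|c| + 1 by rewrite ltr_wpDl.
have [g Cg fg] := af _ (divr_gt0 e0 c0).
exists (fun x => c * g x); first exact: CZ.
under eq_fun do rewrite -mulrBr.
rewrite nrmZ; last exact: (L2B l2f (C_L2 Cg)).
apply: (@le_trans _ _ ((`|c| + 1) * (e / (`|c| + 1)))).
  by apply: ler_pM => //; [exact: nrm_ge0|rewrite lerDl].
by rewrite mulrC divfK// gt_eqF.
Qed.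

Lemma approx_byB f g : approx_by f -> approx_by g ->
  approx_by (fun x => f x - g x).
Proof.
move=> af ag; under eq_fun do rewrite -mulN1r.
by apply: approx_byD => //; exact: approx_byZ.
Qed.

Lemma approx_by_sum n (F : 'I_n -> T -> R) : (forall i, approx_by (F i)) ->
  approx_by (fun x => \sum_(i < n) F i x).
Proof.
move=> aF; elim: n F aF => [|n ih] F aF.
  by under eq_fun do rewrite big_ord0; exact: approx_byC.
by under eq_fun do rewrite big_ord_recr/=; apply: approx_byD => //; exact: ih.
Qed.

Lemma L2_indic (A : set T) : measurable A -> L2 P (\1_A).
Proof.
move=> mA; apply: (L2_le _ (L2_cst P 1)); first exact/measurable_indicP.
by move=> x; rewrite indicE; case: (_ \in _); rewrite ?normr1 ?normr0.
Qed.

Hypothesis approx_by_indic : forall A : set T, measurable A -> approx_by (\1_A).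

Import HBNNSimple.

Lemma approx_by_nnsfun (f : {nnsfun T >-> R}) : approx_by f.
Proof.
rewrite (_ : (f : T -> R) = fun x => \sum_(i < #|` fset_set (range f)|)
  ((fset_set (range f))`_i * \1_(f @^-1` [set (fset_set (range f))`_i]) x));
  last by apply/funext => x; exact: fimfunEord.
apply: approx_by_sum => i; apply: approx_byZ; apply: approx_by_indic.
by rewrite -[X in measurable X]setTI; exact: measurable_funP.
Qed.

(** Simple approximations from below leave an error between 0 and [h], so [h] itself dominates
    it. *)
Lemma approx_by_ge0 h : L2 P h -> (forall x, 0 <= h x) -> approx_by h.
Proof.
move=> l2h h0; apply: approx_by_lim => // e e0.
have mh : measurable_fun setT (EFin \o h).
  by apply/measurable_EFinP; exact: (L2_measurable l2h).
pose h_ n : T -> R := nnsfun_approx measurableT mh n.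
have h_le n x : h_ n x <= h x.
  rewrite /h_ nnsfun_approxE -lee_fin.
  by apply: (@le_approx _ _ _ setT (EFin \o h)) => // y _; rewrite lee_fin.
have h_ge0 n x : 0 <= h_ n x by exact: fun_ge0.
have l2h_ n : L2 P (h_ n) by case: (approx_by_nnsfun (nnsfun_approx measurableT mh n)).
have [|x|n hn] := @L2_dominated h_ h h e l2h_ l2h l2h _ _ e0.
- by move=> n x; rewrite ger0_norm ?subr_ge0// lerBlDr lerDl.
- have := @cvg_nnsfun_approx _ _ _ setT measurableT (EFin \o h) mh _ x I.
  by move=> /(_ (fun y _ => h0 y)) /fine_cvg.
by exists (h_ n) => //; exact: approx_by_nnsfun.
Qed.

Lemma approx_by_L2 h : L2 P h -> approx_by h.
Proof.
move=> l2h.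
have l2n : L2 P (fun x => `|h x|).
  apply: (L2_le _ l2h) => [|x]; last by rewrite normr_id.
  by apply: measurableT_comp => //; exact: (L2_measurable l2h).
rewrite (_ : h = fun x => 2^-1 * (`|h x| + h x) - 2^-1 * (`|h x| - h x)); last first.
  by apply/funext => x; field.
apply: approx_byB; apply: approx_byZ; apply: approx_by_ge0.
- exact: L2D.
- by move=> x; rewrite -lerBlDr sub0r; case: (ler_normlP (h x) `|h x| (lexx _)).
- exact: L2B.
- by move=> x; rewrite subr_ge0 ler_norm.
Qed.

End density.

(** * Density of test functions in the Gaussian L^2 space *)

Section gaussian_density.
Variable R : realType.
Implicit Types f g h : R -> R.
Local Notation gamma := (gaussian R).
Local Notation L2 := (L2 gamma).
Local Notation nrm := (nrm gamma).

Lemma bmfun_L2 f : bmfun f -> L2 f.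
Proof.
move=> bf; apply/L2P; split; first by case: bf.
exact: (bmfun_integrable (bmfunX 2 bf)).
Qed.

Definition test f := smooth f /\ csupp f.

Lemma test_bmfun f : test f -> bmfun f.
Proof. by move=> [sf cf]; apply: cont_csupp_bmfun => //; exact: smooth_cont. Qed.

Lemma test_L2 f : test f -> L2 f.
Proof. by move=> /test_bmfun/bmfun_L2. Qed.

Lemma test0 : test (fun=> 0).
Proof. by split; [exact: smooth_cst|exists 0]. Qed.

Lemma testD f g : test f -> test g -> test (fun x => f x + g x).
Proof. by move=> [? ?] [? ?]; split; [exact: smoothD|exact: csuppD]. Qed.

Lemma testB f g : test f -> test g -> test (fun x => f x - g x).
Proof. by move=> [? ?] [? ?]; split; [exact: smoothB|exact: csuppB]. Qed.

Lemma testMl f g : smooth f -> test g -> test (fun x => f x * g x).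
Proof. by move=> ? [? ?]; split; [exact: smoothM|exact: csuppMr]. Qed.

Lemma testZ c f : test f -> test (fun x => c * f x).
Proof. by apply: testMl; exact: smooth_cst. Qed.

Lemma test_cutoffn n : test (cutoffn n).
Proof. by split; [exact: smooth_cutoffn|exact: csupp_cutoffn]. Qed.

Local Notation appr := (approx_by gamma test).

Lemma approx_by_cvg (f_ : nat -> R -> R) f (M : R) :
  (forall n, appr (f_ n)) -> L2 f -> (forall n x, `|f x - f_ n x| <= M) ->
  (forall x, f_ n x @[n --> \oo] --> f x) -> appr f.
Proof.
move=> af l2f fM ff.
apply: (approx_by_lim (P := gamma) test_L2) => // e e0.
have l2f_ n : L2 (f_ n) by case: (af n).
by have [n hn] := L2_dominated (P := gamma) l2f_ l2f (L2_cst gamma M) fM ff e0; exists (f_ n).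
Qed.

Lemma appr_cst1 : appr (fun=> 1).
Proof.
apply: (@approx_by_cvg (@cutoffn R) _ 1).
- by move=> n; apply: (approx_byC (P := gamma) test_L2); exact: test_cutoffn.
- exact: L2_cst.
- move=> n x; rewrite ger0_norm ?subr_ge0 ?cutoffn_le1//.
  by rewrite gerBl cutoffn_ge0.
- exact: cutoffn_cvg.
Qed.

(** Steps of slope growing with [n], placed to the right of [a], vanish at [a] and so converge
    pointwise to the indicator of the open ray. *)
Lemma appr_ray (a : R) : appr (\1_(`]a, +oo[%classic)).
Proof.
pose f_ n x : R := step (n%:R * (x - a)) * cutoffn n x.
apply: (@approx_by_cvg f_ _ 1).
- move=> n; apply: (approx_byC (P := gamma) test_L2).
  apply: testMl; last exact: test_cutoffn.
  apply: (@smooth_comp _ (@step R)); first exact: smooth_step.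
  apply: smoothM; first exact: smooth_cst.
  by apply: smoothB; [exact: smooth_id|exact: smooth_cst].
- exact: L2_indic.
- move=> n x; have f0 : 0 <= f_ n x by rewrite mulr_ge0 ?step_ge0 ?cutoffn_ge0.
  have f1 : f_ n x <= 1.
    by rewrite mulr_ile1 ?step_ge0 ?cutoffn_ge0 ?step_le1 ?cutoffn_le1.
  by rewrite indicE; case: (_ \in _); rewrite ler_norml; apply/andP; split => /=; lra.
- move=> x; rewrite -[X in _ --> X]mulr1; apply: cvgM; last exact: cutoffn_cvg.
  apply: cvg_near_cst; have [xa|xa] := leP x a.
    apply: nearW => n; rewrite indicE memNset/= ?in_itv/= ?andbT -?leNgt//.
      by rewrite step0// mulr_ge0_le0// subr_le0.
    by apply/negP; rewrite -leNgt.
  rewrite indicE mem_set/= ?in_itv/= ?xa//.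
  near=> n; apply: step1; rewrite -ler_pdivrMr ?subr_gt0//.
  by near: n; exact: nbhs_infty_ger.
Unshelve. all: by end_near. Qed.

(** Dynkin's argument: open rays form a generating class stable under intersection, and the sets
    with approximable indicator are stable under complements and disjoint countable unions. *)
Lemma appr_indic (A : set (measurableTypeR R)) : measurable A -> appr (\1_A).
Proof.
move=> mA.
have gen : @measurable _ (measurableTypeR R) = <<s @RGenOInfty.G R >>.
  exact: RGenOInfty.measurableE.
apply: (dynkin_induction (P := fun A : set (measurableTypeR R) => appr (\1_A)) gen).
- move=> _ _ [a ->] [c ->]; exists (Num.max a c).
  by apply/seteqP; split=> x /=; rewrite !in_itv/= !andbT gt_max => /andP.
- by rewrite indicT; exact: appr_cst1.
- by move=> _ [a ->]; exact: appr_ray.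
- move=> S mS aS; rewrite (_ : \1_(~` S) = fun x => 1 - \1_S x).
    by apply: (approx_byB (P := gamma) test_L2 testD testZ) => //; exact: appr_cst1.
  by apply/funext => x; rewrite !indicE in_setC; case: (_ \in _); rewrite ?subrr ?subr0.
- move=> F mF tF aF.
  (* By disjointness at most one summand is nonzero at [x], so the partial sums are eventually
     constant there and stay within distance 1 of the limit. *)
  have key x : exists k, forall n, \sum_(i < n) \1_(F i) x =
      if (k <= n)%N then \1_(\bigcup_k F k) x else 0 :> R.
    have [[k _ Fkx]|nFx] := pselect ((\bigcup_k F k) x); last first.
      exists 0%N => n; rewrite leq0n big1 => [|i _]; rewrite indicE memNset// => Fix.
      by apply: nFx; exists i.
    have F0 i : i != k -> \1_(F i) x = 0 :> R.
      move=> ik; rewrite indicE memNset// => Fix; move/eqP: ik; apply.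
      by apply: tF => //; exists x.
    exists k.+1 => n; case: ifPn => [kn|].
      rewrite (bigD1 (Ordinal kn))//= big1 ?addr0 => [|i ik]; last exact: F0.
      by rewrite !indicE !mem_set//; exists k.
    rewrite -ltnNge ltnS => nk; apply: big1 => i _; apply: F0.
    by rewrite neq_ltn (leq_trans (ltn_ord i) nk).
  apply: (@approx_by_cvg (fun n x => \sum_(i < n) \1_(F i) x) _ 1).
  + by move=> n; exact: (approx_by_sum (P := gamma) test_L2 test0 testD).
  + by apply: L2_indic; exact: bigcup_measurable.
  + move=> n x; have [k ->] := key x; rewrite indicE.
    by case: ifP => _; case: (_ \in _); rewrite ?subrr ?subr0 ?normr0 ?normr1.
  + move=> x; apply: cvg_near_cst; have [k hk] := key x.
    by exists k => // n /= kn; rewrite hk kn.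
- by rewrite -[X in X A]gen.
Qed.

Lemma test_dense h (e : R) : L2 h -> 0 < e ->
  exists2 g, test g & nrm (fun x => h x - g x) <= e.
Proof.
move=> l2h e0.
have [_] := approx_by_L2 (P := gamma) test_L2 test0 testD testZ appr_indic l2h.
exact.
Qed.

End gaussian_density.

(** * Algebra of the operator and its action on cutoffs *)

Section operator_on_tests.
Variables (R : realType) (b : R).
Hypothesis b_gt0 : 0 < b.
Implicit Types f g h : R -> R.
Local Notation gamma := (gaussian R).
Local Notation L2 := (L2 gamma).
Local Notation nrm := (nrm gamma).
Local Notation A := (Aop b).
Local Notation wt := (wt b).
Local Notation dwt := (dwt b).

Lemma test_Aop f : test f -> test (A f).
Proof. by move=> [sf cf]; split; [exact: smooth_Aop|exact: csupp_Aop]. Qed.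

Lemma Aop_drv f f' f'' (x : R) : (forall x : R, is_derive x 1 f (f' x)) ->
  (forall x : R, is_derive x 1 f' (f'' x)) ->
  A f x = - (wt x * f'' x + (dwt x - x * wt x) * f' x).
Proof.
move=> ff' f'f''.
rewrite /Aop.
have -> : derive1 f = f' by apply/funext => y; exact: drv_derive1.
by rewrite (drv_derive1 (f'f'' x)).
Qed.

(** The cross term vanishes wherever one factor is locally constant, which is how cutoffs are
    applied below. *)
Lemma AopM f g (x : R) : smooth f -> smooth g ->
  A (fun x => f x * g x) x =
  f x * A g x + g x * A f x - 2 * wt x * derive1 f x * derive1 g x.
Proof.
move=> sf sg.
have df y := smooth_drv y sf; have dg y := smooth_drv y sg.
have ddf y := smooth_drv y (smooth_derive1 sf).
have ddg y := smooth_drv y (smooth_derive1 sg).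
have d1 (y : R) : is_derive y 1 (fun x => f x * g x)
  (derive1 f y * g y + f y * derive1 g y) by drv.
have d2 (y : R) : is_derive y 1 (fun x => derive1 f x * g x + f x * derive1 g x)
  ((derive1 (derive1 f) y * g y + derive1 f y * derive1 g y) +
   (derive1 f y * derive1 g y + f y * derive1 (derive1 g) y)) by drv.
rewrite (Aop_drv x d1 d2) /Aop; clear d1 d2.
move: (derive1 (derive1 f) x) (derive1 (derive1 g) x) (derive1 f x).
move: (derive1 g x) (f x) (g x) (wt x) (dwt x).
by move=> *; ring.
Qed.

Lemma AopZ c f (x : R) : smooth f -> A (fun x => c * f x) x = c * A f x.
Proof.
move=> sf; have df y := smooth_drv y sf.
have ddf y := smooth_drv y (smooth_derive1 sf).
have d1 (y : R) : is_derive y 1 (fun x => c * f x) (c * derive1 f y).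
  by derive_as; rewrite /= mul0r add0r.
have d2 (y : R) :
    is_derive y 1 (fun x => c * derive1 f x) (c * derive1 (derive1 f) y).
  by derive_as; rewrite /= mul0r add0r.
rewrite (Aop_drv x d1 d2) /Aop; clear d1 d2.
move: (derive1 (derive1 f) x) (derive1 f x) (f x) (wt x) (dwt x).
by move=> *; ring.
Qed.

Lemma AopD f g (x : R) : smooth f -> smooth g ->
  A (fun x => f x + g x) x = A f x + A g x.
Proof.
move=> sf sg.
have df y := smooth_drv y sf; have dg y := smooth_drv y sg.
have ddf y := smooth_drv y (smooth_derive1 sf).
have ddg y := smooth_drv y (smooth_derive1 sg).
have d1 (y : R) :
    is_derive y 1 (fun x => f x + g x) (derive1 f y + derive1 g y) by drv.
have d2 (y : R) : is_derive y 1 (fun x => derive1 f x + derive1 g x)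
  (derive1 (derive1 f) y + derive1 (derive1 g) y) by drv.
rewrite (Aop_drv x d1 d2) /Aop; clear d1 d2.
move: (derive1 (derive1 f) x) (derive1 (derive1 g) x) (derive1 f x).
move: (derive1 g x) (f x) (g x) (wt x) (dwt x).
by move=> *; ring.
Qed.

Lemma AopB f g (x : R) : smooth f -> smooth g ->
  A (fun x => f x - g x) x = A f x - A g x.
Proof.
move=> sf sg; rewrite (_ : (fun x => f x - g x) = fun x => f x + (-1) * g x).
  rewrite AopD ?AopZ ?mulN1r//.
  by apply: smoothM => //; exact: smooth_cst.
by apply/funext => y; rewrite mulN1r.
Qed.

Lemma wt_le1 (x : R) : wt x <= 1.
Proof.
rewrite /wt invf_le1 ?wt_den_gt0// lerDl.
by rewrite mulr_ge0 ?sqr_ge0// ltW.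
Qed.

Lemma x_wt_le (x : R) : `|x| * wt x <= 1 + b^-1.
Proof.
rewrite /wt ler_pdivrMr ?wt_den_gt0//.
have -> : (1 + b^-1) * (1 + b * x ^+ 2) = 1 + `|x| ^+ 2 + b * x ^+ 2 + b^-1.
  by rewrite real_normK ?num_real//; field; rewrite gt_eqF.
have : `|x| <= 1 + `|x| ^+ 2.
  rewrite -subr_ge0 (_ : _ - _ = (`|x| - 2^-1) ^+ 2 + 3 / 4); last by field.
  by rewrite addr_ge0 ?sqr_ge0//; lra.
have : 0 <= b * x ^+ 2 by rewrite mulr_ge0 ?sqr_ge0// ltW.
have : 0 < b^-1 by rewrite invr_gt0.
lra.
Qed.

Definition drift_bound : R := (2 * b + 1) * (1 + b^-1).

(** The drift factors as [- (x wt) (2 b wt + 1)], and [x wt] is bounded because the weight decays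
    quadratically. *)
Lemma drift_le (x : R) : `|dwt x - x * wt x| <= drift_bound.
Proof.
have w0 := wt_gt0 b_gt0 x.
have -> : dwt x - x * wt x = - (x * wt x) * (2 * b * wt x + 1).
  by rewrite /dwt /wt; field; exact: wt_den_neq0.
have b0 : 0 <= 2 * b by rewrite mulr_ge0// ltW.
have e0 : 0 <= 2 * b * wt x + 1 by rewrite addr_ge0// mulr_ge0// ltW.
rewrite normrM normrN normrM (ger0_norm (ltW w0)) (ger0_norm e0) mulrC.
apply: ler_pM => //; last exact: x_wt_le.
  by rewrite mulr_ge0// ltW.
by rewrite lerD2r ler_piMr// wt_le1.
Qed.

Lemma drift_bound_gt0 : 0 < drift_bound.
Proof.
have b0 := b_gt0; have bi0 : 0 < b^-1 by rewrite invr_gt0.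
by rewrite mulr_gt0//; lra.
Qed.

Lemma cutoffn_derive1 n (x : R) :
  derive1 (cutoffn n) x = derive1 (@cutoff R) (n.+1%:R^-1 * x) / n.+1%:R.
Proof.
apply: drv_derive1; rewrite /cutoffn.
have d1 (y : R) : is_derive y 1 (fun y => n.+1%:R^-1 * y) n.+1%:R^-1.
  by derive_as; rewrite /= mul0r add0r mulr1.
exact: (drv_comp (smooth_drv (n.+1%:R^-1 * x) (@smooth_cutoff R)) (d1 x)).
Qed.

Lemma cutoffn_derive2 n (x : R) :
  derive1 (derive1 (cutoffn n)) x =
  derive1 (derive1 (@cutoff R)) (n.+1%:R^-1 * x) / n.+1%:R ^+ 2.
Proof.
apply: drv_derive1.
rewrite (_ : derive1 (cutoffn n) = fun x =>
   derive1 (@cutoff R) (n.+1%:R^-1 * x) / n.+1%:R); last first.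
  by apply/funext => y; exact: cutoffn_derive1.
have d1 (y : R) : is_derive y 1 (fun y => n.+1%:R^-1 * y) n.+1%:R^-1.
  by derive_as; rewrite /= mul0r add0r mulr1.
have d2 := drv_comp (smooth_drv (n.+1%:R^-1 * x)
  (smooth_derive1 (@smooth_cutoff R))) (d1 x).
apply: is_derive_eq (drvM d2 (drv_cst _ _)) _.
by rewrite /= mulr0 addr0 -mulrA -invfM -expr2.
Qed.

(** Dilation supplies the powers of [n.+1], and the coefficients of [A] are bounded. Cutoffs
    therefore approximate the constant 1 together with its image 0 under [A]. *)
Lemma cutoffn_bounds : exists2 K : R, 0 < K & forall n (x : R),
  [/\ `|derive1 (@cutoffn R n) x : R| <= K / n.+1%:R,
      `|derive1 (derive1 (@cutoffn R n)) x : R| <= K / n.+1%:R ^+ 2 &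
      `|A (cutoffn n) x : R| <= K / n.+1%:R].
Proof.
have s1 := smooth_derive1 (@smooth_cutoff R).
have c0 : csupp (@cutoff R) by exists 2; exact: cutoff0.
have [K1 [K10 hK1]] := csupp_bounded (smooth_cont s1) (csupp_derive1 c0).
have [K2 [K20 hK2]] := csupp_bounded (smooth_cont (smooth_derive1 s1))
  (csupp_derive1 (csupp_derive1 c0)).
have d0 := drift_bound_gt0.
have dK0 : 0 < drift_bound * K1 by rewrite mulr_gt0.
exists (K1 + K2 + drift_bound * K1); first by rewrite !addr_gt0.
move=> n x; have n0 : 0 < n.+1%:R :> R by rewrite ltr0n.
have n1 : n.+1%:R^-1 <= 1 :> R by rewrite invf_le1// ler1n.
have b1 : `|derive1 (cutoffn n) x| <= K1 / n.+1%:R.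
  by rewrite cutoffn_derive1 normrM normfV (ger0_norm (ltW n0)) ler_pM2r ?invr_gt0.
have b2 : `|derive1 (derive1 (cutoffn n)) x| <= K2 / n.+1%:R ^+ 2.
  rewrite cutoffn_derive2 normrM normfV (ger0_norm (sqr_ge0 n.+1%:R)).
  by rewrite ler_pM2r// invr_gt0 exprn_gt0.
split.
- apply: le_trans b1 _; rewrite ler_pM2r ?invr_gt0//; lra.
- apply: le_trans b2 _; rewrite ler_pM2r ?invr_gt0 ?exprn_gt0//; lra.
- rewrite /Aop normrN; apply: le_trans (ler_normD _ _) _; rewrite !normrM.
  apply: (@le_trans _ _ (K2 / n.+1%:R + drift_bound * (K1 / n.+1%:R))).
    apply: lerD.
      rewrite -[X in _ <= X]mul1r; apply: ler_pM => //.
        by rewrite ger0_norm ?wt_le1// ltW// wt_gt0.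
      apply: le_trans b2 _; rewrite ler_pM2l// expr2 invfM.
      by apply: ler_piMr => //; rewrite invr_ge0 ltW.
    by apply: ler_pM => //; exact: drift_le.
  have -> : K2 / n.+1%:R + drift_bound * (K1 / n.+1%:R) =
    (K2 + drift_bound * K1) / n.+1%:R by rewrite mulrDl mulrA.
  by rewrite ler_pM2r ?invr_gt0//; lra.
Qed.

End operator_on_tests.

(** * Coercivity off the constants and the explicit solution of [A f = h] *)

Section coercivity.
Variables (R : realType) (b a l : R).
Hypotheses (b_gt0 : 0 < b) (a_gt0 : 0 < a) (a_le_b : a <= b) (l_gt0 : 0 < l)
  (alb : a * (1 - a) = l * b) (la : l <= 1 - a).
Implicit Types f g h : R -> R.
Local Notation gamma := (gaussian R).
Local Notation L2 := (L2 gamma).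
Local Notation nrm := (nrm gamma).
Local Notation A := (Aop b).
Local Notation wt := (wt b).

Lemma Eg_sqrB f c : bmfun f ->
  Eg (fun x => (f x - c) ^+ 2) = Eg (fun x => f x ^+ 2) - 2 * c * Eg f + c ^+ 2.
Proof.
move=> bf; rewrite (_ : (fun x => (f x - c) ^+ 2) =
   fun x => f x ^+ 2 - 2 * c * f x + c ^+ 2); last by apply/funext => x; ring.
have b2 : bmfun (fun x => f x ^+ 2) by exact: bmfunX.
have b1 : bmfun (fun x => 2 * c * f x) by apply: bmfunM => //; exact: bmfun_cst.
rewrite EgD; [|exact: bmfunB|exact: bmfun_cst].
by rewrite EgB// EgZ// Eg_cst.
Qed.

(** The second moment about [f 0] exceeds the variance by [(Eg f - f 0)^2]. *)
Lemma variance_le f : test f ->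
  l * (Eg (fun x => f x ^+ 2) - Eg f ^+ 2) <= Eg (fun x => A f x * f x).
Proof.
move=> tf; have [sf cf] := tf; have bf := test_bmfun tf.
rewrite (Aop_ibp b_gt0 sf cf sf).
rewrite (_ : (fun x => wt x * derive1 f x * derive1 f x) =
  fun x => wt x * derive1 f x ^+ 2); last first.
  by apply/funext => x; rewrite -mulrA -expr2.
apply: le_trans (poincare b_gt0 a_gt0 a_le_b (ltW l_gt0) alb la sf cf).
rewrite ler_pM2l// Eg_sqrB// -subr_ge0.
have -> : Eg (fun x => f x ^+ 2) - 2 * f 0 * Eg f + f 0 ^+ 2 -
  (Eg (fun x => f x ^+ 2) - Eg f ^+ 2) = (Eg f - f 0) ^+ 2 by ring.
exact: sqr_ge0.
Qed.

(** The residual is paired with [f - Eg f]; as [A f] has mean zero, the pairing equals the energy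
    minus [z] times the variance. *)
Lemma coercive f z : test f ->
  (l - z) * nrm (fun x => f x - Eg f) <= nrm (fun x => A f x - z * f x).
Proof.
move=> tf; have [sf cf] := tf; have bf := test_bmfun tf.
have bA := test_bmfun (test_Aop b_gt0 tf).
pose m := Eg f; pose g x := f x - m.
have bg : bmfun g by apply: bmfunB => //; exact: bmfun_cst.
pose r x := A f x - z * f x.
have br : bmfun r.
  by apply: bmfunB => //; apply: bmfunM => //; exact: bmfun_cst.
have g2 : nrm g ^+ 2 = Eg (fun x => f x ^+ 2) - m ^+ 2.
  by rewrite nrm_sqr -[LHS]/(Eg (fun x => (f x - m) ^+ 2)) Eg_sqrB// -/m; ring.
have rg : Eg (fun x => r x * g x) = Eg (fun x => A f x * f x) - z * nrm g ^+ 2.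
  rewrite (_ : (fun x => r x * g x) = fun x =>
    A f x * f x - m * A f x - (z * f x ^+ 2 - z * m * f x)); last first.
    by apply/funext => x; rewrite /r /g; move: (A f x) => y; ring.
  have bc c : bmfun (fun=> c : R) by exact: bmfun_cst.
  have b1 : bmfun (fun x => A f x * f x) by exact: bmfunM.
  have b2 : bmfun (fun x => f x ^+ 2) by exact: bmfunX.
  have b3 : bmfun (fun x => m * A f x) by exact: bmfunM.
  have b4 : bmfun (fun x => z * f x ^+ 2) by exact: bmfunM.
  have b5 : bmfun (fun x => z * m * f x) by exact: bmfunM.
  rewrite EgB; [|exact: bmfunB|exact: bmfunB].
  rewrite EgB// EgB// !EgZ// (Eg_Aop b_gt0 sf cf) g2 /m; ring.
have [g0|g0] := eqVneq (nrm g) 0; first by rewrite -/g g0 mulr0 nrm_ge0.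
have gp : 0 < nrm g by rewrite lt_def g0 nrm_ge0.
rewrite -(ler_pM2r gp).
have := cauchy_schwarz (bmfun_L2 br) (bmfun_L2 bg).
rewrite -[\int[_]_x _]/(Eg (fun x => r x * g x)) rg.
move=> /(le_trans (ler_norm _)); apply: le_trans.
rewrite -/g -mulrA -expr2 mulrBl lerD2r g2; exact: variance_le.
Qed.

(** Pairing the residual with the constant 1 leaves [- z * Eg f]. *)
Lemma mean_le f z : test f ->
  `|z| * `|Eg f| <= nrm (fun x => A f x - z * f x).
Proof.
move=> tf; have [sf cf] := tf; have bf := test_bmfun tf.
have bA := test_bmfun (test_Aop b_gt0 tf).
have bz : bmfun (fun x => z * f x) by apply: bmfunM => //; exact: bmfun_cst.
have br : bmfun (fun x => A f x - z * f x) by exact: bmfunB.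
have := cauchy_schwarz (bmfun_L2 br) (L2_cst gamma 1).
rewrite nrm_cst normr1 mulr1; under eq_Rintegral do rewrite mulr1.
rewrite -[\int[_]_x _]/(Eg (fun x => A f x - z * f x)).
by rewrite EgB// EgZ// (Eg_Aop b_gt0 sf cf) sub0r normrN normrM.
Qed.

(** Coercivity controls [f] up to constants and [mean_le] controls the constant; the latter needs
    [z != 0], since constants are in the kernel of [A]. *)
Lemma resolvent_bound f z : test f -> z < l -> z != 0 ->
  nrm f <= ((l - z)^-1 + `|z|^-1) * nrm (fun x => A f x - z * f x).
Proof.
move=> tf zl z0; have bf := test_bmfun tf.
have lz : 0 < l - z by rewrite subr_gt0.
have nz : 0 < `|z| by rewrite normr_gt0.
have l2f := test_L2 tf; have l2c := L2_cst gamma (Eg f).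
have := nrmD (L2B l2f l2c) l2c.
under eq_fun do rewrite subrK.
rewrite nrm_cst => /le_trans; apply; rewrite mulrDl lerD//.
  by rewrite ler_pdivlMl//; exact: coercive.
by rewrite ler_pdivlMl//; exact: mean_le.
Qed.

(** Outside a segment the function is constant on each side, hence takes there its values at the
    endpoints. *)
Lemma csupp_derive1_bounded f : smooth f -> csupp (derive1 f) ->
  exists2 M : R, 0 < M & forall x, `|f x| <= M.
Proof.
move=> sf /(csupp_ge 1)[N [N1 hN]].
have N0 : 0 < N by lra.
have NN : - N <= N by lra.
have cst x y : (forall t, t \in `[x, y] -> N <= `|t|) -> x <= y -> f y = f x.
  move=> hxy xy; have [||c cxy] := @MVT_segment _ f (derive1 f) x y xy.
  - by move=> t _; exact: smooth_drv.
  - by apply: continuous_subspaceT; exact: smooth_cont.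
  - by rewrite (hN c (hxy _ cxy)) mul0r => /eqP; rewrite subr_eq0 => /eqP.
have [c _ hc] := @EVT_max R (fun x => `|f x|) (- N) N NN
  (continuous_subspaceT (fun x => cvg_norm (smooth_cont sf (x:=x)))).
exists (`|f c| + 1) => [|x]; first by rewrite ltr_wpDl.
apply: (@le_trans _ _ `|f c|); last by rewrite lerDl.
have [xN|xN] := leP x (- N).
  rewrite -(cst x (- N))//; first by apply: hc; rewrite in_itv/= lexx.
  by move=> t; rewrite in_itv/= => /andP[_ tN]; rewrite ler_normr lerNr tN orbT.
have [Nx|Nx] := leP N x.
  rewrite (cst N x)//; first by apply: hc; rewrite in_itv/= lexx NN.
  by move=> t; rewrite in_itv/= => /andP[Nt _]; rewrite ler_normr Nt.
by apply: hc; rewrite in_itv/= !ltW.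
Qed.

(** One integration of [(wt * rho * f')' = - h * rho] gives [wt * rho * f' = H], and mean zero is
    what makes [H] vanish at both ends. Only [f'] has compact support: [f] may tend to different
    constants on the two sides. *)
Lemma poisson_equation h : test h -> Eg h = 0 ->
  exists f, [/\ smooth f, csupp (derive1 f) & A f =1 h].
Proof.
move=> [sh ch] Eh.
have srho : smooth (@rho R).
  apply: (@smooth_ext _ (fun x => normal_peak 1 * expR (- x ^+ 2 / 2))).
    by move=> x; rewrite rhoE.
  apply: smoothM; first exact: smooth_cst.
  apply: (@smooth_comp _ (@expR R)); first exact: smooth_expR.
  apply: smoothM; last exact: smooth_cst.
  by apply: smoothN; apply: smoothX; exact: smooth_id.
have [N [N1 hN]] := csupp_ge 1 ch.
have N0 : 0 < N by lra.
have shr : smooth (fun x => h x * rho x) by exact: smoothM.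
have [F dF] := csupp_primitive (smooth_cont shr) (csuppMl _ ch).
have FN : F N = F (- N).
  have := Eg_FTC (smooth_cont sh) N0 hN dF.
  by rewrite Eh => /esym/eqP; rewrite subr_eq0 => /eqP.
pose H x := F N - F x.
have dH (x : R) : is_derive x 1 H (- (h x * rho x)).
  by rewrite /H; derive_as; rewrite sub0r.
have sF : smooth F by exact: smooth_primitive dF shr.
have sH : smooth H by apply: smoothB => //; exact: smooth_cst.
have cstF x y : (forall t, t \in `[x, y] -> N <= `|t|) -> x <= y -> F y = F x.
  move=> hxy xy; have [|c cxy] := @MVT_segment _ F (fun x => h x * rho x) x y xy.
  - by apply: continuous_subspaceT; exact: smooth_cont.
  - by rewrite (hN c (hxy _ cxy)) !mul0r => /eqP; rewrite subr_eq0 => /eqP.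
have cH : csupp H.
  exists N => x; rewrite ler_normr /H => /orP[Nx|Nx].
    rewrite (cstF N x) ?subrr// => t; rewrite in_itv/= => /andP[Nt _].
    by rewrite ler_normr Nt.
  rewrite FN (cstF x (- N)) ?subrr//; last by rewrite lerNr.
  move=> t; rewrite in_itv/= => /andP[_ tN].
  by rewrite ler_normr lerNr tN orbT.
pose k x := H x * (wt x * rho x)^-1.
have wr0 x : wt x * rho x != 0.
  by rewrite mulf_neq0// gt_eqF ?rho_gt0// wt_gt0.
have sk : smooth k.
  apply: smoothM => //; apply: smoothV => //.
  by apply: smoothM => //; exact: smooth_wt.
have ck : csupp k by exact: csuppMl.
have [f df] := csupp_primitive (smooth_cont sk) ck.
have f'k : derive1 f = k by apply/funext => x; exact: drv_derive1.
exists f; split; first exact: smooth_primitive df sk.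
  by rewrite f'k.
move=> x; have dk := smooth_drv x sk.
have := dH x; have -> : H = fun x => wt x * rho x * k x.
  by apply/funext => y; rewrite /k mulrCA mulfV// mulr1.
have dw := wt_drv b_gt0 x; have dr := rho_drv x.
have dd : is_derive x 1 (fun x => wt x * rho x * k x)
  ((dwt b x * rho x + wt x * (- x * rho x)) * k x + wt x * rho x * derive1 k x).
  by drv.
move=> dH'; have := drv_derive1 dH'; rewrite (drv_derive1 dd) => e.
have r0 : rho x != 0 by rewrite gt_eqF// rho_gt0.
apply: (mulIf r0); rewrite -[RHS]opprK -e /Aop f'k.
move: (derive1 k x) (k x) (wt x) (dwt b x) (rho x) => *; ring.
Qed.

End coercivity.

(** * Dense range of [A - z] on test functions *)

Section dense_range.
Variables (R : realType) (b a l : R).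
Hypotheses (b_gt0 : 0 < b) (a_gt0 : 0 < a) (a_le_b : a <= b) (l_gt0 : 0 < l)
  (alb : a * (1 - a) = l * b) (la : l <= 1 - a).
Implicit Types f g h : R -> R.
Local Notation gamma := (gaussian R).
Local Notation L2 := (L2 gamma).
Local Notation nrm := (nrm gamma).
Local Notation A := (Aop b).
Local Notation wt := (wt b).

Lemma small_div (C e N : R) : 0 < e ->
  exists n : nat, C / n.+1%:R <= e /\ N < n.+1%:R.
Proof.
move=> e0; exists (Num.truncn (Num.max (C / e) N)).
have := truncnS_gt (Num.max (C / e) N).
rewrite gt_max => /andP[h1 h2]; split=> //.
by rewrite ler_pdivrMr ?ltr0n// mulrC -ler_pdivrMr// ltW.
Qed.

Lemma cutoffn_choice (C e : R) : 0 <= C -> 0 < e ->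
  exists n : nat, 2^-1 <= Eg (@cutoffn R n) /\ C / n.+1%:R <= e.
Proof.
move=> C0 e0; have [n [hn _]] := small_div C 0 e0.
have half : (2^-1 : R) < 1 by rewrite invf_lt1// ltr1n.
have [N _ hN] := cvgr_ge (1 : R) (@Eg_cutoffn_cvg R) _ half.
exists (maxn n N); split; first by apply: hN => /=; exact: leq_maxr.
apply: le_trans hn; rewrite ler_wpM2l// lef_pV2 ?posrE ?ltr0n// ler_nat ltnS.
exact: leq_maxl.
Qed.

(** Mean zero is asked of data and solutions alike: coercivity then bounds the full norm of [f], and
    the residuals keep mean zero, so the solving step can be iterated. *)
Definition solvable0 z := forall h, test h -> Eg h = 0 -> forall e : R, 0 < e ->
  exists f, [/\ test f, Eg f = 0 & nrm (fun x => A f x - z * f x - h x) <= e].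

Lemma cutoffn_derive1_eq0 n (x : R) : `|x| < n.+1%:R -> derive1 (cutoffn n) x = 0.
Proof.
move=> xn; apply: drv_derive1; apply: (@drv_local _ (fun=> 1)).
near=> y; rewrite cutoffn1//.
have : `|x - y| < n.+1%:R - `|x|.
  near: y; apply/nbhs_ballP; exists (n.+1%:R - `|x|) => //=.
  by rewrite subr_gt0.
have := ler_normD (y - x) x; rewrite subrK distrC => h1 h2; lra.
Unshelve. all: by end_near. Qed.

(** A multiple of a cutoff replaces the constant that would correct the mean; a cutoff of mean at
    least one half keeps the coefficient below [2 * |Eg f|]. *)
Lemma Eg_test_correct f (n : nat) : test f -> 2^-1 <= Eg (@cutoffn R n) ->
  Eg (fun x => f x - Eg f / Eg (@cutoffn R n) * cutoffn n x) = 0 /\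
  `|Eg f / Eg (@cutoffn R n)| <= 2 * `|Eg f|.
Proof.
move=> tf En; have E0 : 0 < Eg (@cutoffn R n).
  by apply: lt_le_trans En; rewrite invr_gt0.
have bc := @bmfun_cutoffn R n.
split.
  rewrite EgB ?EgZ//; last 2 first.
  - exact: test_bmfun.
  - by apply: bmfunM => //; exact: bmfun_cst.
  by rewrite divfK ?subrr// gt_eqF.
rewrite normrM mulrC; apply: ler_wpM2r => //.
rewrite normfV (ger0_norm (ltW E0)) -[X in _ <= X]invrK.
by rewrite lef_pV2 ?posrE ?invr_gt0.
Qed.

Lemma solvable0_0 : solvable0 0.
Proof.
move=> h th Eh e e0.
have e20 : 0 < e / 2 by rewrite divr_gt0.
have [F [sF cF AF]] := poisson_equation b_gt0 th Eh.
have [M M0 FM] := csupp_derive1_bounded sF cF.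
have [K K0 hK] := @cutoffn_bounds R b b_gt0.
have [N1 hN1] := cF.
have [N [N1N hN]] := csupp_ge N1 (proj2 th).
(* With [n.+1 > N] the cutoff varies only where [F] is locally constant and [h = 0]. The cross term
   vanishes, and the error is [F * A (cutoffn n)], at most [M * K / n.+1]. *)
have [n [hn Nn]] := small_div (M * K) N e20.
pose f1 x := cutoffn n x * F x.
have tf1 : test f1.
  split; first by apply: smoothM => //; exact: smooth_cutoffn.
  by apply: csuppMl; exact: csupp_cutoffn.
have Af1 x : A f1 x = h x + F x * A (cutoffn n) x.
  rewrite /f1 AopM//; last exact: smooth_cutoffn.
  have [xN|xN] := leP N `|x|.
    by rewrite AF (hN x)// (hN1 x) ?(le_trans N1N)// !(mulr0, subr0).
  have xn : `|x| < n.+1%:R := lt_trans xN Nn.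
  rewrite cutoffn_derive1_eq0// cutoffn1 ?ltW// AF.
  by rewrite mulr0 mul0r subr0 mul1r.
clearbody f1.
have C0 : 0 <= 2 * `|Eg f1| * K by rewrite !mulr_ge0// ltW.
(* The second cutoff restores mean zero; its index comes after [f1] because the mean of [f1] enters
   the bound. *)
have [m [Em hm]] := cutoffn_choice C0 e20.
have [E0 cb] := Eg_test_correct tf1 Em.
move: (Eg f1 / _) E0 cb => c E0 cb.
pose f x := f1 x - c * cutoffn m x.
have tcm : test (fun x => c * cutoffn m x) by apply: testZ; exact: test_cutoffn.
have tf : test f by exact: testB.
exists f; split=> //.
have l2d : L2 (fun x => A f x - 0 * f x - h x).
  by apply/test_L2/testB => //; apply: testB; [exact: test_Aop|exact: testZ].
rewrite -[e](ger0_norm (ltW e0)); apply: nrm_le_cst => // x.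
rewrite mul0r subr0 /f AopB ?AopZ//; try exact: smooth_cutoffn; last 2 first.
- by case: tf1.
- by case: tcm.
rewrite Af1 (_ : _ - h x = F x * A (cutoffn n) x - c * A (cutoffn m) x); last first.
  by move: (A (cutoffn n) x) (A (cutoffn m) x) (h x) (F x) => u v y t; ring.
have [_ _ hAn] := hK n x; have [_ _ hAm] := hK m x.
move: (A (cutoffn n) x) (A (cutoffn m) x) hAn hAm => u v hu hv.
apply: le_trans (ler_normB _ _) _; rewrite !normrM (splitr e); apply: lerD.
- apply: le_trans hn; rewrite -[X in _ <= X]mulrA.
  by apply: ler_pM; [exact: normr_ge0|exact: normr_ge0|exact: FM|exact: hu].
- apply: le_trans hm; rewrite -[X in _ <= X]mulrA.
  by apply: ler_pM; [exact: normr_ge0|exact: normr_ge0|exact: cb|exact: hv].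
Qed.

(** Solving with [z'] leaves the residual [(z - z') g], smaller than the previous one by the factor
    [q = |z - z'| / (l - z')] through coercivity: a Neumann series carried out on approximate
    solutions. *)
Lemma solvable0_step z' z : z' < l -> `|z - z'| < l - z' ->
  solvable0 z' -> solvable0 z.
Proof.
move=> z'l zz' sz' h th Eh e e0.
have lz' : 0 < l - z' by rewrite subr_gt0.
pose q := `|z - z'| / (l - z').
have q0 : 0 <= q by rewrite divr_ge0// ltW.
have q1 : q < 1 by rewrite ltr_pdivrMr// mul1r.
have e20 : 0 < e / 2 by rewrite divr_gt0.
(* Each round adds at most [2 * dl = (1 - q) * e / 2], so the bound [q^k * nrm h + e / 2] reproduces
   itself and the errors do not accumulate. *)
pose dl := (1 - q) * e / 4.
have dl0 : 0 < dl by rewrite divr_gt0// mulr_gt0// subr_gt0.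
have key k : exists f, [/\ test f, Eg f = 0 &
    nrm (fun x => h x - (A f x - z * f x)) <= q ^+ k * nrm h + e / 2].
  elim: k => [|k [f [tf Ef hf]]].
    exists (fun=> 0); split; [exact: test0|exact: Eg_cst|].
    have A0 x : A (fun=> 0) x = 0.
      apply: etrans (etrans (AopZ b 0 x (smooth_cst (0 : R))) (mul0r _)).
      by congr (Aop b _ x); apply/funext => y; rewrite mul0r.
    have -> : (fun x => h x - (A (fun=> 0) x - z * 0)) = h.
      by apply/funext => x; rewrite A0 mulr0 !subr0.
    by rewrite expr0 mul1r lerDl ltW.
  have [sf cf] := tf.
  pose r x := h x - (A f x - z * f x).
  have tzf : test (fun x => z * f x) by exact: testZ.
  have tA : test (fun x => A f x - z * f x) by apply: testB => //; exact: test_Aop.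
  have tr : test r by exact: testB.
  have Er : Eg r = 0.
    rewrite EgB; [|exact: test_bmfun..].
    rewrite EgB; [|exact/test_bmfun/test_Aop|exact: test_bmfun].
    rewrite EgZ; last exact: test_bmfun.
    by rewrite Eh Ef (Eg_Aop b_gt0 sf cf) mulr0 !subr0.
  have [g [tg Eg0 hg]] := sz' r tr Er dl dl0.
  have [sg cg] := tg.
  exists (fun x => f x + g x); split; first exact: testD.
    by rewrite EgD ?Ef ?Eg0 ?addr0//; exact: test_bmfun.
  pose s x := A g x - z' * g x - r x.
  have tAg : test (fun x => A g x - z' * g x).
    by apply: testB; [exact: test_Aop|exact: testZ].
  have ts : test s by exact: testB.
  have -> : (fun x => h x - (A (fun y => f y + g y) x - z * (f x + g x))) =
      fun x => (z - z') * g x - s x.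
    apply/funext => x; rewrite AopD// /s /r.
    by move: (A f x) (A g x) => u v; ring.
  have tzg : test (fun x => (z - z') * g x) by exact: testZ.
  apply: le_trans (nrmB (test_L2 tzg) (test_L2 ts)) _.
  rewrite nrmZ; last exact: test_L2.
  have ng : nrm g <= (l - z')^-1 * (dl + nrm r).
    rewrite -ler_pdivrMl ?invr_gt0// invrK.
    have := coercive b_gt0 a_gt0 a_le_b l_gt0 alb la z' tg.
    rewrite Eg0; under eq_fun do rewrite subr0.
    move=> /le_trans; apply.
    have := nrmD (test_L2 ts) (test_L2 tr).
    by under eq_fun do rewrite subrK; move=> /le_trans; apply; rewrite lerD2r.
  have h1 : `|z - z'| * nrm g <= q * (dl + nrm r).
    by rewrite /q -mulrA; apply: ler_wpM2l.
  have h2 : q * nrm r <= q * (q ^+ k * nrm h + e / 2) by exact: ler_wpM2l.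
  have h3 : q * dl <= dl by rewrite ler_piMl// ltW.
  apply: le_trans (lerD h1 hg) _.
  rewrite mulrDr exprS.
  have -> : q * q ^+ k * nrm h + e / 2 =
    q * (q ^+ k * nrm h + e / 2) + 2 * dl by rewrite /dl; field.
  lra.
have [k hk] : exists k, q ^+ k * nrm h <= e / 2.
  have qn : `|q| < 1 by rewrite ger0_norm.
  have cv : q ^+ k * nrm h @[k --> \oo] --> 0.
    by rewrite -[X in _ --> X](mul0r (nrm h)); apply: cvgM; [exact: cvg_expr|exact: cvg_cst].
  have [k _ hk] := cvgr_le (0 : R) cv _ e20.
  by exists k; exact: (hk k (leqnn k)).
have [f [tf Ef hf]] := key k; exists f; split=> //.
rewrite nrmB_sym; apply: le_trans hf _.
by rewrite [X in _ <= X]splitr lerD2r.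
Qed.

(** From 0 one step reaches all of [[0, l[]. Negative values are reached by steps of length at most
    [l / 2], always allowed because [l - z' >= l] for [z' <= 0]. *)
Lemma solvable0_lt z : z < l -> solvable0 z.
Proof.
move=> zl.
suff H n : forall z, - (n%:R * (l / 2)) <= z -> z < l -> solvable0 z.
  have l20 : 0 < l / 2 by rewrite divr_gt0.
  have [n [_ hn]] := small_div 0 (- z / (l / 2)) ltr01.
  apply: (H n.+1) => //; rewrite lerNl -ler_pdivrMr//.
  exact: ltW.
elim: n => [|n ih] {zl} {}z nz zl.
  apply: (@solvable0_step 0) => //; last exact: solvable0_0.
  by rewrite !subr0 ger0_norm// -[leLHS]oppr0 -(mul0r (l / 2)).
have l0 := l_gt0.
have [zn|zn] := leP (- (n%:R * (l / 2))) z; first exact: ih.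
have n0 : 0 <= n%:R * (l / 2) by rewrite mulr_ge0// divr_ge0// ltW.
apply: (@solvable0_step (- (n%:R * (l / 2)))).
- by lra.
- rewrite -[n.+1]addn1 natrD mulrDl mul1r in nz.
  by rewrite ltr0_norm; lra.
- by apply: ih => //; lra.
Qed.

(** The mean of [h] is carried by [c * cutoffn m], which [- z^-1 * c * cutoffn m] solves up to
    [A (cutoffn m)]; the rest has mean zero. *)
Lemma solvable z h (e : R) : z < l -> z != 0 -> test h -> 0 < e ->
  exists2 f, test f & nrm (fun x => A f x - z * f x - h x) <= e.
Proof.
move=> zl z0 th e0.
have e20 : 0 < e / 2 by rewrite divr_gt0.
have [K K0 hK] := @cutoffn_bounds R b b_gt0.
have C0 : 0 <= `|z|^-1 * (2 * `|Eg h|) * K.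
  by rewrite !mulr_ge0 ?invr_ge0// ltW.
have [m [Em hm]] := cutoffn_choice C0 e20.
have [E0 cb] := Eg_test_correct th Em.
move: (Eg h / _) E0 cb => c E0 cb.
have tcm (c' : R) : test (fun x : R => c' * cutoffn m x) by apply: testZ; exact: test_cutoffn.
have [f1 [tf1 _ hf1]] := solvable0_lt zl (testB th (tcm c)) E0 e20.
pose f x := f1 x - z^-1 * c * cutoffn m x.
have tf : test f by exact: testB.
exists f => //.
pose s x := A f1 x - z * f1 x - (h x - c * cutoffn m x).
pose t x := z^-1 * c * A (cutoffn m) x.
have ts : test s.
  apply: testB; last exact: testB.
  by apply: testB; [exact: test_Aop|exact: testZ].
have tt : test t by apply: testZ; apply: test_Aop => //; exact: test_cutoffn.
have -> : (fun x => A f x - z * f x - h x) = fun x => s x - t x.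
  apply/funext => x; rewrite /f AopB; [|by case: tf1|by case: (tcm (z^-1 * c))].
  rewrite AopZ; last exact: smooth_cutoffn.
  rewrite /s /t; move: (A f1 x) (A (cutoffn m) x) (cutoffn m x) => u v y.
  by field.
apply: le_trans (nrmB (test_L2 ts) (test_L2 tt)) _.
rewrite [e]splitr lerD//; apply: le_trans hm.
have Cm0 : 0 <= `|z|^-1 * (2 * `|Eg h|) * K / m.+1%:R by rewrite divr_ge0.
rewrite -[leRHS]ger0_norm//; apply: nrm_le_cst => [|x]; first exact: test_L2.
have [_ _ hA] := hK m x; rewrite /t.
move: (A (cutoffn m) x) hA => u hu; rewrite !normrM normfV.
rewrite -[X in _ <= X]mulrA; apply: ler_pM => //.
by apply: ler_wpM2l => //; rewrite invr_ge0.
Qed.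

End dense_range.

(** * Truncated ground states as almost eigenvectors *)

Section weyl_sequence.
Variables (R : realType) (b a l : R).
Hypotheses (b_gt0 : 0 < b) (a_gt0 : 0 < a) (a_le_b : a <= b) (a_le : a <= 2^-1)
  (l_gt0 : 0 < l) (alb : a * (1 - a) = l * b).
Implicit Types f g h k : R -> R.
Local Notation gamma := (gaussian R).
Local Notation nrm := (nrm gamma).
Local Notation A := (Aop b).
Local Notation wt := (wt b).
Local Notation dwt := (dwt b).

Lemma Eg_le_support k (N M : R) : continuous k -> 0 < N ->
  (forall x, N <= `|x| -> k x = 0) -> (forall x, k x * rho x <= M) ->
  Eg k <= M * (2 * N).
Proof.
move=> kc N0 kN kM.
have [P dP] : exists P : R -> R, forall x : R, is_derive x 1 P (k x * rho x).
  apply: csupp_primitive; last by apply: csuppMl; exists N.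
  by move=> x; apply: cvgM; [exact: kc|exact: rho_cont].
rewrite (Eg_FTC kc N0 kN dP).
have NN : - N < N by lra.
have [|c _ ->] := @MVT _ P (fun x => k x * rho x) (- N) N NN (fun x _ => dP x).
  by apply: continuous_subspaceT => x; exact: drv_continuous (dP x).
rewrite opprK -mulr2n -[N *+ 2]mulr_natl ler_pM2r//.
by rewrite mulr_gt0.
Qed.

(** The primitive of [k * rho] is nondecreasing, and the mean value theorem bounds its growth on
    []x, y[]. *)
Lemma Eg_ge_interval k (x y m : R) : continuous k -> csupp k ->
  (forall x, 0 <= k x) -> x < y ->
  (forall t, t \in `]x, y[ -> m <= k t * rho t) -> m * (y - x) <= Eg k.
Proof.
move=> kc ks k0 xy km.
have [P dP] : exists P : R -> R, forall x : R, is_derive x 1 P (k x * rho x).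
  apply: csupp_primitive; last by apply: csuppMl.
  by move=> t; apply: cvgM; [exact: kc|exact: rho_cont].
have [N [N1 kN]] := csupp_ge (1 + `|x| + `|y|) ks.
have x0 := normr_ge0 x; have y0 := normr_ge0 y.
have N0 : 0 < N by lra.
have Pc : continuous P by move=> t; exact: drv_continuous (dP t).
have mono s t : s <= t -> P s <= P t.
  move=> st; have [|c _] := @MVT_segment _ P (fun x => k x * rho x) s t st (fun x _ => dP x).
    exact: continuous_subspaceT.
  move=> e; rewrite -subr_ge0 e mulr_ge0 ?subr_ge0// mulr_ge0//.
  by rewrite ltW// rho_gt0.
rewrite (Eg_FTC kc N0 kN dP).
have [|c cxy e] := @MVT _ P (fun x => k x * rho x) x y xy (fun x _ => dP x).
  exact: continuous_subspaceT.
have h1 : P y <= P N by apply: mono; have := ler_norm y; lra.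
have h2 : P (- N) <= P x by apply: mono; have := lerNnormlW (lexx `|x|); lra.
have h3 : m * (y - x) <= P y - P x.
  by rewrite e ler_pM2r ?subr_gt0//; exact: km.
lra.
Qed.

Definition grow (x : R) : R := expR (a / 2 * x ^+ 2).

Lemma grow_gt0 (x : R) : 0 < grow x. Proof. exact: expR_gt0. Qed.

Lemma grow_drv (x : R) : is_derive x 1 grow (a * x * grow x).
Proof. by rewrite /grow; derive_as; rewrite /=; field. Qed.

(** The exponent is nonpositive exactly when [a <= 1/2]; at [a = 1/2] the product is constant, the
    borderline of integrability. *)
Lemma grow_sqr_rho (x : R) :
  grow x ^+ 2 * rho x = normal_peak 1 * expR (- (2^-1 - a) * x ^+ 2).
Proof.
rewrite rhoE mulrCA /grow -expRM_natl -expRD; congr (_ * expR _).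
by field.
Qed.

Definition ground (x : R) : R := x * grow x.

Lemma ground_drv (x : R) : is_derive x 1 ground ((1 + a * x ^+ 2) * grow x).
Proof.
have dg := grow_drv x.
by rewrite /ground; derive_as; rewrite /=; ring.
Qed.

Lemma ground_drv2 (x : R) :
  is_derive x 1 (fun x => (1 + a * x ^+ 2) * grow x)
    ((3 * a * x + a ^+ 2 * x ^+ 3) * grow x).
Proof.
have dg := grow_drv x.
by derive_as; rewrite /=; ring.
Qed.

Lemma smooth_ground : smooth ground.
Proof.
apply: smoothM; first exact: smooth_id.
apply: (@smooth_comp _ (@expR R)); first exact: smooth_expR.
by apply: smoothM; [exact: smooth_cst|apply: smoothX; exact: smooth_id].
Qed.

(** By [alb] the terms of the order of the ground state cancel. What remains vanishes for [a = b],
    [l = 1 - b], and otherwise is of the order of [grow], without the factor [x]. *)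
Lemma Aop_ground (x : R) : A ground x - l * ground x =
  - (grow x * (x * wt x * (3 * a - 1 + l - 2 * (b * (1 + a * x ^+ 2) * wt x)))).
Proof.
rewrite (Aop_drv b x ground_drv ground_drv2) /ground.
have W1 : wt x * (1 + b * x ^+ 2) = 1 by rewrite mulVf ?wt_den_neq0.
have -> : dwt x = - (2 * b * x) * wt x ^+ 2 by rewrite /wt exprVn.
move: (wt x) (grow x) W1 => W E W1.
apply/eqP; rewrite -subr_eq0.
have -> : - (W * ((3 * a * x + a ^+ 2 * x ^+ 3) * E) +
    (- (2 * b * x) * W ^+ 2 - x * W) * ((1 + a * x ^+ 2) * E)) -
    l * (x * E) - - (E * (x * W * (3 * a - 1 + l - 2 * (b * (1 + a * x ^+ 2) * W)))) =
  l * x * E * (W * (1 + b * x ^+ 2) - 1) +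
  W * x ^+ 3 * E * (a * (1 - a) - l * b) by ring.
by rewrite W1 alb !subrr !mulr0 addr0.
Qed.

Definition weyl n (x : R) : R := cutoffn n x * ground x.

Lemma test_weyl n : test (weyl n).
Proof.
split; first by apply: smoothM; [exact: smooth_cutoffn|exact: smooth_ground].
by apply: csuppMl; exact: csupp_cutoffn.
Qed.

Lemma sqr_wt_le (x : R) : b * (x ^+ 2 * wt x) <= 1.
Proof.
rewrite mulrA /wt ler_pdivrMr ?wt_den_gt0// mul1r.
by rewrite lerDr.
Qed.

Lemma weight_ground_le (x : R) : 0 <= (1 + a * x ^+ 2) * wt x <= 1.
Proof.
have a0 := ltW a_gt0.
apply/andP; split.
  apply: mulr_ge0; last exact/ltW/wt_gt0.
  by apply: addr_ge0 => //; apply: mulr_ge0 => //; exact: sqr_ge0.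
rewrite /wt ler_pdivrMr ?wt_den_gt0// mul1r lerD2l.
by rewrite ler_wpM2r ?sqr_ge0.
Qed.

(** Differentiating the cutoff costs [O(1/n)] times the weights [x wt], [x dwt - x^2 wt] and
    [(1 + a x^2) wt], all bounded by the decay of [wt]; [D] carries the defect of the ground state
    itself. *)
Lemma weyl_bound (D : R) : (forall x, `|A ground x - l * ground x| <= D * grow x) ->
  exists2 C : R, 0 < C & forall n x,
  `|A (weyl n) x - l * weyl n x| <= (C / n.+1%:R + D) * grow x.
Proof.
move=> hD; have [K K0 hK] := @cutoffn_bounds R b b_gt0.
have bi0 : 0 < b^-1 by rewrite invr_gt0.
exists (K * (1 + b^-1) + (2 + b^-1) * K + 2 * K).
  by rewrite !addr_gt0 ?mulr_gt0// addr_gt0.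
move=> n x.
have [h1 h2 _] := hK n x.
have n0 : 0 < n.+1%:R :> R by rewrite ltr0n.
have n1 : n.+1%:R^-1 <= 1 :> R by rewrite invf_le1// ler1n.
have h2' : `|derive1 (derive1 (cutoffn n)) x| <= K / n.+1%:R.
  apply: le_trans h2 _; rewrite ler_pM2l// expr2 invfM.
  by apply: ler_piMr => //; rewrite invr_ge0 ltW.
have c0 := cutoffn_ge0 n x; have c1 := cutoffn_le1 n x.
have E0 := grow_gt0 x.
have W0 := wt_gt0 b_gt0 x.
have xW := x_wt_le b_gt0 x.
have x2W : x ^+ 2 * wt x <= b^-1.
  by rewrite -[leRHS]mulr1 ler_pdivlMl//; exact: sqr_wt_le.
have W1 := wt_le1 b_gt0 x.
have /andP[g0 g1] := weight_ground_le x.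
have drift : `|x * dwt x - x ^+ 2 * wt x| <= 2 + b^-1.
  have -> : x * dwt x - x ^+ 2 * wt x = - ((x ^+ 2 * wt x) * (2 * b * wt x + 1)).
    have -> : dwt x = - (2 * b * x) * wt x ^+ 2 by rewrite /wt exprVn.
    by move: (wt x) => W; ring.
  have b0 := ltW b_gt0.
  have p1 : 0 <= x ^+ 2 * wt x by apply: mulr_ge0; [exact: sqr_ge0|exact: ltW].
  have p2 : 0 <= 2 * b * wt x + 1.
    by apply: addr_ge0 => //; apply: mulr_ge0; [exact: mulr_ge0|exact: ltW].
  rewrite normrN ger0_norm; last exact: mulr_ge0.
  have -> : 2 + b^-1 = b^-1 * (2 * b * 1 + 1) by field; rewrite gt_eqF.
  apply: ler_pM => //.
  by rewrite lerD2r ler_pM2l// mulr_gt0.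
rewrite /weyl AopM; [|exact: smooth_cutoffn|exact: smooth_ground].
rewrite (drv_derive1 (ground_drv x)) {2}/Aop.
have := hD x.
move: (A ground x) => u hu.
rewrite /ground in hu *.
move: (cutoffn n x) (derive1 (cutoffn n) x) (derive1 (derive1 (cutoffn n)) x)
  (wt x) (dwt x) (grow x) h1 h2' c0 c1 E0 W0 xW x2W W1 g0 g1 drift hu.
move=> c c' c'' W W' E h1 h2' c0 c1 E0 W0 xW x2W W1 g0 g1 drift hu.
have -> : c * u + x * E * - (W * c'' + (W' - x * W) * c') -
   2 * W * c' * ((1 + a * x ^+ 2) * E) - l * (c * (x * E)) =
   c * (u - l * (x * E)) -
   (x * W * c'' + (x * W' - x ^+ 2 * W) * c' +
     2 * ((1 + a * x ^+ 2) * W) * c') * E by ring.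
apply: le_trans (ler_normB _ _) _; rewrite addrC [X in _ <= X]mulrDl; apply: lerD; last first.
  rewrite normrM ger0_norm// -[X in _ <= X]mul1r; apply: ler_pM => //.
rewrite normrM (gtr0_norm E0) ler_pM2r//.
rewrite [X in _ <= X]mulrDl [X in _ <= X + _]mulrDl; apply: le_trans (ler_normD _ _) _; apply: lerD.
  apply: le_trans (ler_normD _ _) _; apply: lerD.
    rewrite [K * _]mulrC -[X in _ <= X]mulrA normrM; apply: ler_pM => //.
    by rewrite normrM (gtr0_norm W0).
  by rewrite -[X in _ <= X]mulrA normrM; apply: ler_pM.
rewrite -[X in _ <= X]mulrA normrM; apply: ler_pM => //.
by rewrite normrM ger0_norm// (ger0_norm g0) ler_piMr.
Qed.

Lemma ground_defect (x : R) : `|A ground x - l * ground x| <=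
  (1 + b^-1) * (`|3 * a - 1 + l| + 2 * b) * grow x.
Proof.
rewrite Aop_ground normrN normrM (gtr0_norm (grow_gt0 x)) [leRHS]mulrC.
rewrite ler_pM2l ?grow_gt0// normrM; apply: ler_pM => //.
  by rewrite normrM (gtr0_norm (wt_gt0 b_gt0 x)); exact: x_wt_le.
apply: le_trans (ler_normB _ _) _; rewrite lerD2l.
have /andP[g0 g1] := weight_ground_le x.
have b0 : 0 < 2 * b by rewrite mulr_gt0.
have -> : 2 * (b * (1 + a * x ^+ 2) * wt x) = 2 * b * ((1 + a * x ^+ 2) * wt x).
  by rewrite !mulrA.
rewrite ger0_norm; last by apply: mulr_ge0 => //; exact: ltW.
by rewrite -[X in _ <= X]mulr1 ler_pM2l.
Qed.

Lemma derive1_eq0 f (N : R) : (forall x, N <= `|x| -> f x = 0) ->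
  forall x, N < `|x| -> derive1 f x = 0.
Proof.
move=> fN x xN; apply: drv_derive1; apply: (@drv_local _ (fun=> 0)).
near=> y; rewrite fN//.
have : `|x - y| < `|x| - N.
  by near: y; apply/nbhs_ballP; exists (`|x| - N) => //=; rewrite subr_gt0.
have := ler_normD (x - y) y; rewrite subrK => h1 h2; lra.
Unshelve. all: by end_near. Qed.

(** [grow^2 * rho] is at most [normal_peak 1] since [a <= 1/2], so the integral is bounded by the
    length of the support. *)
Lemma weyl_upper n (M : R) :
  (forall x, `|A (weyl n) x - l * weyl n x| <= M * grow x) ->
  nrm (fun x => A (weyl n) x - l * weyl n x) ^+ 2
  <= M ^+ 2 * normal_peak 1 * (6 * n.+1%:R).
Proof.
move=> hM; rewrite nrm_sqr.
have n0 : 0 < n.+1%:R :> R by rewrite ltr0n.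
have w0 x : 2 * n.+1%:R <= `|x| -> weyl n x = 0.
  by move=> xn; rewrite /weyl cutoffn0// mul0r.
(* A derivative is known to vanish only strictly beyond the radius where the function does, hence
   the radii 2, 5/2 and 3 times [n.+1]. *)
have w1 x : 5 / 2 * n.+1%:R <= `|x| -> derive1 (weyl n) x = 0.
  by move=> xn; apply: (derive1_eq0 w0); lra.
have w2 x : 3 * n.+1%:R <= `|x| -> derive1 (derive1 (weyl n)) x = 0.
  by move=> xn; apply: (derive1_eq0 w1); lra.
have tB : test (fun x => A (weyl n) x - l * weyl n x).
  by apply: testB; [apply: test_Aop => //; exact: test_weyl|apply/testZ/test_weyl].
have -> : 6 * n.+1%:R = 2 * (3 * n.+1%:R) :> R by ring.
rewrite -[leLHS]/(Eg (fun x => (A (weyl n) x - l * weyl n x) ^+ 2)).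
apply: Eg_le_support.
- by apply/smooth_cont/smoothX; case: tB.
- by rewrite mulr_gt0.
- move=> x xn; have e0 : weyl n x = 0 by apply: w0; lra.
  have e1 : derive1 (weyl n) x = 0 by apply: w1; lra.
  have e2 : derive1 (derive1 (weyl n)) x = 0 by apply: w2; lra.
  rewrite /Aop e0 e1 e2.
  by rewrite !(mulr0, addr0, oppr0, subr0) expr0n.
- move=> x; have r0 := rho_gt0 x.
  have h : (A (weyl n) x - l * weyl n x) ^+ 2 <= (M * grow x) ^+ 2.
    rewrite -(real_normK (num_real (_ - _))) lerXn2r ?nnegrE//.
    exact: le_trans (hM x).
  apply: (@le_trans _ _ ((M * grow x) ^+ 2 * rho x)); first by rewrite ler_pM2r.
  rewrite exprMn -mulrA grow_sqr_rho; apply: ler_wpM2l; first exact: sqr_ge0.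
  rewrite ler_piMr ?normal_peak_ge0// expR_le1 mulNr oppr_le0.
  by rewrite mulr_ge0 ?sqr_ge0// subr_ge0.
Qed.

(** Only the interval from [y / 2] to [y] is counted, where the cutoff equals 1. *)
Lemma weyl_lower n (y : R) : 0 < y -> y <= n.+1%:R ->
  (y / 2) ^+ 2 * (normal_peak 1 * expR (- (2^-1 - a) * y ^+ 2)) * (y / 2)
  <= nrm (weyl n) ^+ 2.
Proof.
move=> y0 yn; rewrite nrm_sqr -[leRHS]/(Eg (fun x => weyl n x ^+ 2)).
have -> : (y / 2) ^+ 2 * (normal_peak 1 * expR (- (2^-1 - a) * y ^+ 2)) * (y / 2)
  = (y / 2) ^+ 2 * (normal_peak 1 * expR (- (2^-1 - a) * y ^+ 2)) * (y - y / 2).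
  by congr (_ * _); field.
have [sw cw] := test_weyl n.
apply: Eg_ge_interval.
- exact/smooth_cont/smoothX.
- by under eq_fun do rewrite expr2; exact: csuppMl.
- by move=> x; exact: sqr_ge0.
- by rewrite ltr_pdivrMr// ltr_pMr// ltr1n.
move=> x; rewrite in_itv/= => /andP[yx xy].
have x0 : 0 < x by apply: lt_trans yx; rewrite divr_gt0.
rewrite /weyl cutoffn1 ?mul1r; last first.
  by rewrite gtr0_norm// (le_trans (ltW xy)).
rewrite /ground (exprMn _ x) -[X in _ <= X]mulrA grow_sqr_rho; apply: ler_pM.
- exact: sqr_ge0.
- by rewrite mulr_ge0 ?normal_peak_ge0// expR_ge0.
- by rewrite lerXn2r ?nnegrE ?divr_ge0 ?ltW.
apply: ler_wpM2l; first exact: normal_peak_ge0.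
rewrite ler_expR !mulNr lerN2; apply: ler_wpM2l; first by rewrite subr_ge0.
by rewrite lerXn2r ?nnegrE ?ltW.
Qed.

(* For [b < 1/2] the ground state is an eigenfunction in L^2; for [b >= 1/2] it
   is only a generalized one, and the norm of its truncations grows faster than
   the norm of their images. *)
Lemma weyl_sequence (e : R) : (a = b /\ l = 1 - b) \/ a = 2^-1 -> 0 < e ->
  exists f, [/\ test f, 0 < nrm f &
    nrm (fun x => A f x - l * f x) <= e * nrm f].
Proof.
move=> cases e0.
have peak0 : 0 < normal_peak 1 :> R by rewrite normal_peak_gt0 ?oner_eq0.
have conclude n : 0 < nrm (weyl n) ^+ 2 ->
    nrm (fun x => A (weyl n) x - l * weyl n x) ^+ 2 <= e ^+ 2 * nrm (weyl n) ^+ 2 ->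
    exists f, [/\ test f, 0 < nrm f & nrm (fun x => A f x - l * f x) <= e * nrm f].
  move=> p h; exists (weyl n); split; first exact: test_weyl.
    by rewrite lt_def nrm_ge0 andbT -sqrf_eq0 gt_eqF.
  by rewrite -ler_sqr ?nnegrE ?mulr_ge0 ?nrm_ge0 ?(ltW e0)// exprMn.
case: cases => [[ab lb]|a2].
  have [C C0 hC] : exists2 C : R, 0 < C & forall n x,
      `|A (weyl n) x - l * weyl n x| <= (C / n.+1%:R + 0) * grow x.
    apply: weyl_bound => x; rewrite Aop_ground ab lb mul0r.
    have -> : 3 * b - 1 + (1 - b) - 2 * (b * (1 + b * x ^+ 2) * wt x) = 0.
      have W1 : wt x * (1 + b * x ^+ 2) = 1 by rewrite mulVf ?wt_den_neq0.
      rewrite -[b * _ * _]mulrA [_ * wt x]mulrC W1; ring.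
    by rewrite !mulr0 oppr0 normr0.
  (* The lower bound of [weyl_lower] at [y = 1], independent of [n], while the upper bound decays
     like [1 / n]. *)
  pose c0 : R := (1 / 2) ^+ 2 *
    (normal_peak 1 * expR (- (2^-1 - a) * 1 ^+ 2)) * (1 / 2).
  have c00 : 0 < c0 by rewrite !mulr_gt0 ?expR_gt0.
  have [n [hn _]] := small_div (6 * C ^+ 2 * normal_peak 1) 0
    (mulr_gt0 (exprn_gt0 2 e0) c00).
  have n0 : 0 < n.+1%:R :> R by rewrite ltr0n.
  have low : c0 <= nrm (weyl n) ^+ 2 by apply: weyl_lower; rewrite // ler1n.
  apply: (conclude n); first exact: lt_le_trans low.
  apply: le_trans (weyl_upper (hC n)) _.
  apply: (@le_trans _ _ (e ^+ 2 * c0)); last first.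
    by apply: ler_wpM2l => //; exact: sqr_ge0.
  apply: le_trans hn; rewrite addr0 le_eqVlt; apply/orP; left; apply/eqP.
  by field; rewrite gt_eqF.
have [C C0 hC] := weyl_bound ground_defect.
set D := (1 + b^-1) * _ in hC.
have D0 : 0 <= D.
  have b0 := b_gt0; have bi0 : 0 < b^-1 by rewrite invr_gt0.
  by rewrite mulr_ge0 ?addr_ge0 ?mulr_ge0// ltW.
(* [48 = 6 * 8]: at [y = N] the squared norm is at least of order [N^3 / 8], against [6 * N] for its
   image. *)
have [n [hn _]] := small_div (48 * (C + D) ^+ 2) 0 (exprn_gt0 2 e0).
have n0 : 0 < n.+1%:R :> R by rewrite ltr0n.
have n1 : 1 <= n.+1%:R :> R by rewrite ler1n.
have := @weyl_lower n n.+1%:R n0 (lexx _).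
rewrite a2 subrr oppr0 mul0r expR0 mulr1.
set N : R := n.+1%:R in hn n0 n1 * => low.
apply: (conclude n).
  by apply: lt_le_trans low; rewrite !mulr_gt0 ?exprn_gt0 ?divr_gt0.
apply: le_trans (weyl_upper (hC n)) _; rewrite -/N.
apply: le_trans (ler_wpM2l (sqr_ge0 e) low).
have CD : (C / N + D) ^+ 2 <= (C + D) ^+ 2.
  rewrite lerXn2r ?nnegrE ?addr_ge0 ?divr_ge0 ?(ltW C0) ?(ltW n0)//.
  by rewrite lerD2r ler_pdivrMr// ler_peMr// ltW.
apply: (@le_trans _ _ ((C + D) ^+ 2 * normal_peak 1 * (6 * N))).
  by apply: ler_wpM2r; [rewrite mulr_ge0// ltW|apply: ler_wpM2r => //; exact: ltW].
have -> : e ^+ 2 * ((N / 2) ^+ 2 * normal_peak 1 * (N / 2)) =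
  (e ^+ 2 * N ^+ 2 / 8) * (normal_peak 1 * N) by field.
have -> : (C + D) ^+ 2 * normal_peak 1 * (6 * N) =
  (48 * (C + D) ^+ 2 / 8) * (normal_peak 1 * N) by field.
rewrite ler_pM2r ?mulr_gt0// ler_pM2r ?invr_gt0//.
rewrite ler_pdivrMr// in hn; apply: le_trans hn _.
by apply: ler_wpM2l; [exact: sqr_ge0|rewrite expr2 ler_peMr// ltW].
Qed.

End weyl_sequence.

(** * The closure, its resolvent set and the best constant *)

Section spectral_gap.
Variables (R : realType) (b : R) (sigma : R -> R).
Hypotheses (b_gt0 : 0 < b)
  (sigmaE : forall x : R, sigma x ^+ 2 = 1 / (1 + b * x ^+ 2)).
Implicit Types f g h : R -> R.
Local Notation gamma := (gaussian R).
Local Notation L2 := (L2 gamma).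
Local Notation nrm := (nrm gamma).
Local Notation A := (Aop b).

Definition gap : R := if b < 1 / 2 then 1 - b else 1 / (4 * b).
(** The parameter [a] of the preceding sections, with [gap] as [l]. *)
Definition rate : R := if b < 1 / 2 then b else 2^-1.

Lemma gap_gt0 : 0 < gap.
Proof.
have b0 := b_gt0; rewrite /gap; case: ifPn => [|_]; first by lra.
by rewrite divr_gt0// mulr_gt0.
Qed.

Lemma rate_gt0 : 0 < rate.
Proof. by rewrite /rate; case: ifP; rewrite ?invr_gt0. Qed.

Lemma rate_le_b : rate <= b.
Proof. by rewrite /rate; case: ifPn => // ?; lra. Qed.

Lemma rate_le_half : rate <= 2^-1.
Proof. by rewrite /rate; case: ifPn => // ?; lra. Qed.

Lemma rate_gap : rate * (1 - rate) = gap * b.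
Proof.
rewrite /rate /gap; case: ifPn => _; first by rewrite mulrC.
by field; rewrite gt_eqF.
Qed.

Lemma gap_le_rate : gap <= 1 - rate.
Proof.
have b0 := b_gt0; rewrite /gap /rate; case: ifPn => //; rewrite -leNgt => hb.
rewrite ler_pdivrMr ?mulr_gt0//; lra.
Qed.

Lemma rate_cases : (rate = b /\ gap = 1 - b) \/ rate = 2^-1.
Proof. by rewrite /rate /gap; case: ifPn => _; [left|right]. Qed.

Lemma minus_Lop f : (fun x => - Lop sigma f x) = A f.
Proof.
have sE : (fun y => sigma y ^+ 2) = wt b.
  by apply/funext => y; rewrite sigmaE div1r.
apply/funext => x; rewrite /Lop sE (derive1_wt b_gt0) /Aop.
by rewrite (_ : sigma x ^+ 2 = wt b x)// sigmaE div1r.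
Qed.

Lemma invSn_small (e : R) : 0 < e ->
  exists N : nat, forall n, (N <= n)%N -> n.+1%:R^-1 <= e.
Proof.
move=> e0; have [N [hN _]] := small_div 1 0 e0.
exists N => n Nn; apply: le_trans hN.
by rewrite div1r lef_pV2 ?posrE ?ltr0n// ler_nat ltnS.
Qed.

Lemma L2norm_cvg0P (u : nat -> R -> R) : (forall n, L2 (u n)) ->
  (fun n => L2norm gamma (u n)) @ \oo --> 0%E <->
  forall e : R, 0 < e -> exists N, forall n, (N <= n)%N -> nrm (u n) <= e.
Proof.
move=> l2u; under eq_fun do rewrite L2normE//.
split=> [/fine_cvg/cvgrPdist_le cv e e0|h].
  have [N _ hN] := cv e e0; exists N => n /hN /=.
  by rewrite sub0r normrN ger0_norm ?nrm_ge0.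
apply: cvg_EFin; first by apply: nearW.
apply/cvgrPdist_le => e e0; have [N hN] := h e e0; exists N => // n /= /hN.
by rewrite sub0r normrN ger0_norm ?nrm_ge0.
Qed.

(** Both convergences are merged into one approximation by a test function in the graph norm;
    countable choice gives the sequence back. *)
Lemma minusLP f g : minusL sigma (f, g) <-> [/\ L2 f, L2 g &
  forall e : R, 0 < e -> exists k, [/\ test k,
    nrm (fun x => f x - k x) <= e & nrm (fun x => g x - A k x) <= e]].
Proof.
split=> [[/= l2f l2g [q [Gq fq gq]]]|[l2f l2g h]].
  have tq n : test (q n).1 by have [/C0inftyE] := Gq n.
  have qE n : (q n).2 = A (q n).1 by have [_ ->] := Gq n; exact: minus_Lop.
  have l2fq n : L2 (fun x => f x - (q n).1 x) by apply: L2B => //; exact: test_L2.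
  have l2gq n : L2 (fun x => g x - (q n).2 x).
    by apply: L2B => //; rewrite qE; exact/test_L2/test_Aop.
  split=> // e e0.
  have [N1 h1] := (L2norm_cvg0P l2fq).1 fq e e0.
  have [N2 h2] := (L2norm_cvg0P l2gq).1 gq e e0.
  exists (q (maxn N1 N2)).1; split=> //; first by apply: h1; exact: leq_maxl.
  by rewrite -qE; apply: h2; exact: leq_maxr.
have inv_gt0 n : 0 < n.+1%:R^-1 :> R by rewrite invr_gt0 ltr0n.
have [k hk] := choice (fun n => h _ (inv_gt0 n)).
split=> //=; exists (fun n => (k n, A (k n))).
split.
- move=> n /=; have [tk _ _] := hk n; split; first exact/C0inftyE.
  by rewrite minus_Lop.
- apply/L2norm_cvg0P => [n|e e0].
    by apply: L2B => //; apply: test_L2; have [] := hk n.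
  have [N hN] := invSn_small e0; exists N => n /hN; apply: le_trans.
  by have [] := hk n.
- apply/L2norm_cvg0P => [n|e e0].
    by apply: L2B => //; apply/test_L2/test_Aop => //; have [] := hk n.
  have [N hN] := invSn_small e0; exists N => n /hN; apply: le_trans.
  by have [] := hk n.
Qed.

Lemma minusL_test f : test f -> minusL sigma (f, A f).
Proof.
move=> tf; apply/minusLP; split=> [||e e0]; first exact: test_L2.
  exact/test_L2/test_Aop.
exists f; split=> //.
  by under eq_fun do rewrite subrr; rewrite nrm_cst normr0 ltW.
rewrite (_ : (fun x => _) = fun=> 0) ?nrm_cst ?normr0 ?ltW//.
by apply/funext => x; rewrite subrr.
Qed.

Let lower := @resolvent_bound R b rate gap b_gt0 rate_gt0 rate_le_b gap_gt0
  rate_gap gap_le_rate.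

(** Both sides are continuous in the graph norm, so the bound passes from test functions to the
    closure. *)
Lemma minusL_bound f g z : minusL sigma (f, g) -> z < gap -> z != 0 ->
  nrm f <= ((gap - z)^-1 + `|z|^-1) * nrm (fun x => g x - z * f x).
Proof.
move=> /minusLP[l2f l2g h] zl z0.
set C := _ + _.
have C0 : 0 <= C by rewrite addr_ge0// invr_ge0// subr_ge0 ltW.
have l2zf := L2Z z l2f.
apply/ler_addgt0Pr => e e0.
(* Errors [d] in [f] and in [g] contribute [d] on the left and [C * (d + |z| * d)] on the right, in
   total [d * (1 + C * (1 + |z|)) = e]. *)
have K0 : 0 < 1 + C * (1 + `|z|).
  by rewrite ltr_pwDl// mulr_ge0// addr_ge0.
have [k [tk fk gk]] := h _ (divr_gt0 e0 K0).
set d := e / _ in fk gk.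
have l2k := test_L2 tk; have l2A := test_L2 (test_Aop b_gt0 tk).
have l2zk := L2Z z l2k.
have nf : nrm f <= nrm (fun x => f x - k x) + nrm k.
  have := nrmD (L2B l2f l2k) l2k.
  by rewrite (_ : (fun x => f x - k x + k x) = f)//; apply/funext => x; rewrite subrK.
have nAk : nrm (fun x => A k x - z * k x) <=
    nrm (fun x => g x - z * f x) + (d + `|z| * d).
  have l2gz := L2B l2g l2zf.
  have l2gA := L2B l2g l2A.
  have l2zfk := L2Z z (L2B l2f l2k).
  have -> : (fun x => A k x - z * k x) = fun x => (g x - z * f x) -
      ((g x - A k x) - z * (f x - k x)).
    by apply/funext => x; move: (A k x) => u; ring.
  apply: le_trans (nrmB l2gz (L2B l2gA l2zfk)) _; rewrite lerD2l.
  apply: le_trans (nrmB l2gA l2zfk) _; apply: lerD => //.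
  by rewrite nrmZ; [exact: ler_wpM2l|exact: L2B].
apply: le_trans nf _.
have hk := lower tk zl z0.
have hd : d * (1 + C * (1 + `|z|)) = e by rewrite /d divfK// gt_eqF.
rewrite -hd.
have := le_trans hk (ler_wpM2l C0 nAk); rewrite -/C => h2.
have -> : C * nrm (fun x => g x - z * f x) + d * (1 + C * (1 + `|z|)) =
  d + C * (nrm (fun x => g x - z * f x) + (d + `|z| * d)).
  by move: (nrm _) => u; ring.
exact: lerD.
Qed.

(** For surjectivity, [h] is approximated by test functions and the equation solved approximately.
    The lower bound makes the solutions [u n] Cauchy, and [A (u n)] converges with them to
    [h + z f], so the limit lies in the closure. *)
Lemma resolvent_lt_gap z : z < gap -> z != 0 ->
  resolvent_set gamma (minusL sigma) z.
Proof.
move=> zl z0; split.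
  exists ((gap - z)^-1 + `|z|^-1) => f g fg.
  have [l2f l2g _] := (minusLP f g).1 fg.
  have l2d := L2B l2g (L2Z z l2f).
  by rewrite !L2normE// -EFinM lee_fin; exact: minusL_bound.
move=> h l2h.
pose C := (gap - z)^-1 + `|z|^-1.
have C0 : 0 < C by rewrite addr_gt0// invr_gt0 ?subr_gt0// normr_gt0.
have app n : exists f, test f /\ nrm (fun x => A f x - z * f x - h x) <= n.+1%:R^-1.
  have n0 : 0 < n.+1%:R^-1 / 2 :> R by rewrite divr_gt0// invr_gt0 ltr0n.
  have [k tk hk] := test_dense l2h n0.
  have [f tf hf] := solvable b_gt0 rate_gt0 rate_le_b gap_gt0 rate_gap
    gap_le_rate zl z0 tk n0.
  exists f; split=> //.
  have l2r : L2 (fun x => A f x - z * f x).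
    by apply: L2B; [exact/test_L2/test_Aop|exact/L2Z/test_L2].
  apply: le_trans (nrm_triangle l2r l2h (test_L2 tk)) _.
  by rewrite [leRHS](splitr _) lerD// nrmB_sym.
have [u hu] := choice app.
have tu n : test (u n) by have [] := hu n.
have l2u n := test_L2 (tu n).
have l2Au n := test_L2 (test_Aop b_gt0 (tu n)).
have l2ru n : L2 (fun x => A (u n) x - z * u n x) by apply: L2B => //; exact: L2Z.
have [f [l2f fu]] : exists f, L2 f /\ (forall e : R, 0 < e -> exists N,
    forall n, (N <= n)%N -> nrm (fun x => f x - u n x) <= e).
  apply: (L2_complete (P := gamma)) => // e e0.
  have eC : 0 < e / C / 2 by rewrite !divr_gt0.
  have [N hN] := invSn_small eC; exists N => n m Nn Nm.
  have tnm := testB (tu n) (tu m).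
  apply: le_trans (lower tnm zl z0) _; rewrite -/C.
  rewrite -ler_pdivlMl// mulrC.
  have -> : (fun x => A (fun x => u n x - u m x) x - z * (u n x - u m x)) =
      fun x => (A (u n) x - z * u n x) - (A (u m) x - z * u m x).
    apply/funext => x; rewrite AopB; [|by case: (tu n)|by case: (tu m)].
    by move: (A (u n) x) (A (u m) x) => v w; ring.
  apply: le_trans (nrm_triangle (l2ru n) (l2ru m) l2h) _.
  rewrite [leRHS](splitr _) [nrm (fun x => h x - _)]nrmB_sym lerD//.
    by apply: le_trans (hN n Nn); have [] := hu n.
  by apply: le_trans (hN m Nm); have [] := hu m.
exists f, (fun x => h x + z * f x); split; last first.
  by apply: aeW => x /=; rewrite addrK.
apply/minusLP; split=> //; first by apply: L2D => //; exact: L2Z.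
move=> e e0.
have K0 : 0 < 1 + `|z| by rewrite ltr_pwDl.
pose d := e / (1 + `|z|).
have d0 : 0 < d by rewrite divr_gt0.
have de : d <= e by rewrite ler_pdivrMr// ler_pMr// lerDl.
have [N1 h1] := fu _ d0; have [N2 h2] := invSn_small d0.
set n := maxn N1 N2.
have fn := h1 n (leq_maxl _ _).
have un : nrm (fun x => A (u n) x - z * u n x - h x) <= d.
  by apply: le_trans (h2 n (leq_maxr _ _)); have [] := hu n.
exists (u n); split=> //; first exact: le_trans fn de.
have -> : (fun x => h x + z * f x - A (u n) x) =
    fun x => z * (f x - u n x) - (A (u n) x - z * u n x - h x).
  by apply/funext => x; move: (A (u n) x) => v; ring.
apply: le_trans (nrmB (L2Z z (L2B l2f (l2u n))) (L2B (l2ru n) l2h)) _.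
rewrite nrmZ; last exact: L2B.
have -> : e = `|z| * d + d.
  by rewrite -[X in _ + X]mul1r -mulrDl addrC /d mulrC divfK// gt_eqF.
by apply: lerD => //; exact: ler_wpM2l.
Qed.

(** An almost eigenvector of accuracy [1 / (|C| + 1)] contradicts a resolvent bound with constant
    [C]. *)
Lemma gap_in_spectrum : spectrum gamma (minusL sigma) gap.
Proof.
move=> [[C hC] _].
have D0 : 0 < `|C| + 1 by rewrite ltr_wpDl.
have e0 : 0 < (`|C| + 1)^-1 by rewrite invr_gt0.
have [f [tf nf hf]] := weyl_sequence b_gt0 rate_gt0 rate_le_b rate_le_half
  rate_gap rate_cases e0.
have l2f := test_L2 tf.
have l2d := L2B (test_L2 (test_Aop b_gt0 tf)) (L2Z gap l2f).
have := hC _ _ (minusL_test tf); rewrite !L2normE// -EFinM lee_fin.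
apply/negP; rewrite -ltNge.
apply: le_lt_trans (ler_wpM2r (nrm_ge0 _ _) (ler_norm C)) _.
apply: le_lt_trans (ler_wpM2l (normr_ge0 C) hf) _.
rewrite mulrA gtr_pMl// ltr_pdivrMr// mul1r ltrDl.
exact: ltr01.
Qed.

(** Maximality holds because [gap] is a nonzero point of the spectrum, so any admissible [l'] lies
    below it. *)
Lemma is_spectral_gap_gap : is_spectral_gap gamma (minusL sigma) gap.
Proof.
have g0 := gap_gt0; split=> [z zs|l' hl'].
  have [->|z0] := eqVneq z 0; first by left.
  right; rewrite /= in_itv/= andbT leNgt; apply/negP => zl.
  by apply: zs; exact: resolvent_lt_gap.
have [/= g00|] := hl' _ gap_in_spectrum; first by rewrite g00 ltxx in g0.
by rewrite /= in_itv/= andbT.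
Qed.

Lemma energyE f : test f -> Eg (fun x => A f x * f x) =
  \int[gamma]_x ((derive1 f x) ^+ 2 / (1 + b * x ^+ 2)).
Proof.
move=> [sf cf]; rewrite (Aop_ibp b_gt0 sf cf sf); apply: eq_Rintegral => x _.
by rewrite -mulrA -expr2 mulrC.
Qed.

(** For optimality, an almost eigenvector of accuracy [gap * d] has mean at most [d] times its norm,
    hence nearly full variance, while its energy is at most [gap * (1 + d)] times its squared
    norm. *)
Lemma best_constant : is_largest
  [set l : R | 0 < l /\ forall f : R -> R, C0infty f ->
     l * Var gamma f
     <= \int[gamma]_x ((derive1 f x) ^+ 2 / (1 + b * x ^+ 2))] gap.
Proof.
have g0 := gap_gt0; split.
  split=> // f /C0inftyE tf; rewrite -energyE//.
  exact: (variance_le b_gt0 rate_gt0 rate_le_b gap_gt0 rate_gap gap_le_rate tf).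
move=> l' [l'0 hl']; rewrite leNgt; apply/negP => gl'.
(* The estimates lead to [l' * (1 - d) <= gap], and this [d] makes the left side the midpoint of
   [gap] and [l']. *)
pose d := (l' - gap) / (2 * l').
have d0 : 0 < d by rewrite divr_gt0 ?subr_gt0// mulr_gt0.
have d1 : d < 1 by rewrite ltr_pdivrMr ?mulr_gt0//; lra.
have [f [tf nf hf]] := weyl_sequence b_gt0 rate_gt0 rate_le_b rate_le_half
  rate_gap rate_cases (mulr_gt0 g0 d0).
have [sf cf] := tf; have l2f := test_L2 tf.
have bf := test_bmfun tf; have bA := test_bmfun (test_Aop b_gt0 tf).
have := hl' f ((C0inftyE f).2 tf); rewrite -energyE// => h.
pose m := Eg f.
have mle : `|m| <= d * nrm f.
  have := le_trans (mean_le b_gt0 gap tf) hf.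
  by rewrite (gtr0_norm g0) -mulrA ler_pM2l.
have VE : Var gamma f = nrm f ^+ 2 - m ^+ 2 by rewrite nrm_sqr.
have bg : bmfun (fun x => gap * f x) by apply: bmfunM => //; exact: bmfun_cst.
have en : Eg (fun x => A f x * f x) <= gap * nrm f ^+ 2 + gap * d * nrm f ^+ 2.
  have br : bmfun (fun x => A f x - gap * f x) by exact: bmfunB.
  have -> : Eg (fun x => A f x * f x) =
      Eg (fun x => (A f x - gap * f x) * f x) + gap * nrm f ^+ 2.
    rewrite nrm_sqr -[\int[_]_x _]/(Eg (fun x => f x ^+ 2)) -EgZ; last exact: bmfunX.
    rewrite -EgD; [|exact: bmfunM|by apply: bmfunM; [exact: bmfun_cst|exact: bmfunX]].
    by congr Eg; apply/funext => x; move: (A f x) => u; ring.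
  rewrite addrC lerD2l.
  have := cauchy_schwarz (bmfun_L2 br) l2f.
  move=> /(le_trans (ler_norm _)) /le_trans; apply.
  by rewrite expr2 mulrA ler_pM2r.
have m2 : m ^+ 2 <= d ^+ 2 * nrm f ^+ 2.
  rewrite -exprMn -(real_normK (num_real m)) lerXn2r ?nnegrE//.
  by rewrite mulr_ge0 ?nrm_ge0// ltW.
have : l' * ((1 - d ^+ 2) * nrm f ^+ 2) <= (gap * (1 + d)) * nrm f ^+ 2.
  rewrite mulrDr mulr1 mulrDl; apply: le_trans en; apply: le_trans h.
  by rewrite VE ler_pM2l// mulrBl mul1r lerD2l lerN2.
rewrite mulrA ler_pM2r ?exprn_gt0//.
have -> : l' * (1 - d ^+ 2) = l' * (1 - d) * (1 + d) by ring.
rewrite ler_pM2r; last by rewrite addr_gt0.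
apply/negP; rewrite -ltNge.
have -> : l' * (1 - d) = l' - (l' - gap) / 2 by rewrite /d; field; rewrite gt_eqF.
lra.
Qed.

End spectral_gap.

Theorem theorem2p2 (R : realType) (b : R) (sigma : R -> R)
    (b_gt0 : 0 < b)
    (sigma_gt0 : forall x : R, 0 < sigma x)
    (sigmaE : forall x : R, sigma x ^+ 2 = 1 / (1 + b * x ^+ 2)) :
  let gap : R := if b < 1 / 2 then 1 - b else 1 / (4 * b) in
  is_spectral_gap (gaussian R) (minusL sigma) gap
  /\ is_largest
       [set l : R | 0 < l /\
          forall f : R -> R, C0infty f ->
            l * Var (gaussian R) f
            <= \int[gaussian R]_x ((derive1 f x) ^+ 2 / (1 + b * x ^+ 2))]
       gap.
Proof.
by split; [exact: is_spectral_gap_gap|exact: best_constant].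
Qed.
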